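(* Let $q$ be a prime power, $n\ge 2$, $K=\mathbb{F}_{q^n}$, $F=K(x)$ and $E=F(y)$ with $$y^{q^{n-1}}+y^{q^{n-2}}+\dots+y^q+y=s_{n,2}(x).$$ For every pair $(\tau,\delta)\in K^2$ with $\delta^{q^{n-1}}+\dots+\delta^q+\delta=s_{n,2}(\tau)$ there is a $K$-automorphism $\sigma_{\tau,\delta}$ of $E$ given by $$\sigma(x)=x+\tau,\qquad \sigma(y)=y+x\bigl(\tau^{q}+\tau^{q^2}+\dots+\tau^{q^{n-1}}\bigr)+\delta .$$ These automorphisms map $F$ onto itself and form a subgroup $\Gamma$ of $\mathrm{Aut}(E/K)$ of order $q^{2n-1}$, and $\Gamma$ acts transitively on the set of places of degree one of $E$ other than the unique place lying over the pole of $x$.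
   Context: For a prime power $q$, $s_{n,2}(t)=\sum_{0\le j<k\le n-1}t^{q^j+q^k}$ is the second $(n,q)$-elementary symmetric polynomial (the second elementary symmetric polynomial in $n$ variables evaluated at $(t,t^q,\dots,t^{q^{n-1}})$). *)

(* Defs.v *)
From HB Require Import structures.
From mathcomp Require Import all_boot all_order all_algebra.
Set Implicit Arguments. Unset Strict Implicit. Unset Printing Implicit Defensive.
Import Order.TTheory GRing.Theory.
Local Open Scope ring_scope.

Definition trq (R : pzRingType) (n q : nat) (t : R) : R :=
  \sum_(i < n) t ^+ (q ^ i).

Definition s2 (R : pzRingType) (n q : nat) (t : R) : R :=
  \sum_(k < n) \sum_(j < k) t ^+ (q ^ j + q ^ k).

Section FunctionField.
Variables (K E : fieldType) (iota : {rmorphism K -> E}).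

Definition is_Kaut (s : E -> E) : Prop :=
  [/\ {morph s : a b / a + b}, {morph s : a b / a * b}, s 1 = 1,
      bijective s & forall c, s (iota c) = iota c].

Definition transcendental (x : E) : Prop :=
  forall p : {poly K}, p != 0 -> (map_poly iota p).[x] != 0.

Definition ev1 (x : E) (p : {poly K}) : E := (map_poly iota p).[x].

Definition ev2 (x y : E) (P : {poly {poly K}}) : E :=
  (map_poly (ev1 x) P).[y].

Definition in_Kx (x z : E) : Prop :=
  exists p r : {poly K}, ev1 x r != 0 /\ z = ev1 x p / ev1 x r.

Definition generated_by (x y : E) : Prop :=
  forall z : E, exists P Q : {poly {poly K}},
    ev2 x y Q != 0 /\ z = ev2 x y P / ev2 x y Q.

(* A place of E/K, represented by its valuation ring O (a subset of E):
   a subring of E containing K, different from E, such that for every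
   nonzero z, z \in O or z^-1 \in O. *)
Definition is_place (O : E -> Prop) : Prop :=
  [/\ O 1, (forall a b, O a -> O b -> O (a - b)),
      (forall a b, O a -> O b -> O (a * b)) &
      (forall c, O (iota c))] /\
  [/\
      (exists z, ~ O z) &
      (forall z, z != 0 -> O z \/ O z^-1)].

Definition place_ideal (O : E -> Prop) (z : E) : Prop :=
  O z /\ (z = 0 \/ ~ O z^-1).

(* degree one: the residue class field O/P is K, i.e. every element of O
   is congruent to a constant modulo P *)
Definition degree_one (O : E -> Prop) : Prop :=
  forall a, O a -> exists c : K, place_ideal O (a - iota c).

End FunctionField.

(* Main.v *)
Require Import Defs.
From HB Require Import structures.
From mathcomp Require Import all_boot all_order all_algebra all_field.
From mathcomp Require Import ring zify.
From mathcomp Require boolp classical_sets.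
Set Implicit Arguments. Unset Strict Implicit. Unset Printing Implicit Defensive.
Import Order.TTheory GRing.Theory.
Local Open Scope ring_scope.

(* With N = q^(n-1), h = y/x and w = h - h^q + x, the equation of the curve turns
   into h Tr(x) = sum_i x^(q^i) (w + w^q + ... + w^(q^(i-1))), so E = K(x,w) and w
   satisfies an equation of degree N over K(x).  At a place where x has a pole,
   D = h - (w + ... + w^(q^(n-2))) is integral, and w^N = x - D^q + D ~ x.  The
   monomials x^i w^j, j < N, therefore have distinct pole orders: the place at
   infinity is unique, and, since it exists by Zorn's lemma, 1, w, ..., w^(N-1) are
   independent over K(x).  So any other pair (x',y') on the curve with x'
   transcendental satisfies the same relations over K, and x |-> x', y |-> y'
   extends to E; applied to the pairs of the statement this gives Gamma.  Finally,
   Gamma moves every affine place of degree one to a place centred at the origin,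
   where x is a local parameter, so that only one such place exists. *)


(** The degree of E over K(x) is not among the hypotheses: E is known only through two generators
    and one equation. So x |-> x', y |-> y' cannot be extended by appealing to an irreducible
    polynomial, and the independence of powers has to come from pole orders. The generator y does
    not serve for this. In the normalisation where w has pole order 1, x has order q^(n-1) and y has
    order q^(n-1) + q^(n-2), so for n > 2 the monomials in x and y collide: y^q and x^(q+1) have the
    same order. A place is a bare valuation ring here, with no discreteness given. Every estimate is
    therefore phrased as membership in O of a quotient by a power of x or w, and a nonzero element
    is written as a unit times an integer power of one fixed element (w at infinity, x at the
    origin). Such a factorisation is an identity in E whose exponent and unit serve all the places
    concerned at once, so that two valuation rings can be compared element by element. *)

Section FrobeniusIdentities.
Variables (R : comNzRingType) (q : nat).
Hypothesis q_gt0 : (0 < q)%N.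
Hypothesis exprDq : {morph (fun z : R => z ^+ q) : a b / a + b}.

Lemma exprDqi i : {morph (fun z : R => z ^+ (q ^ i)) : a b / a + b}.
Proof.
elim: i => [|i IHi] a b; first by rewrite !expr1.
by rewrite /= expnS mulnC !exprM IHi exprDq.
Qed.

Lemma expr0qi i : (0 : R) ^+ (q ^ i) = 0.
Proof. by rewrite expr0n expn_eq0 eqn0Ngt q_gt0. Qed.

Lemma exprNqi i (a : R) : (- a) ^+ (q ^ i) = - a ^+ (q ^ i).
Proof. by apply/eqP; rewrite -addr_eq0 -exprDqi addNr expr0qi. Qed.

Lemma exprBqi i : {morph (fun z : R => z ^+ (q ^ i)) : a b / a - b}.
Proof. by move=> a b; rewrite /= exprDqi exprNqi. Qed.

Lemma exprBq : {morph (fun z : R => z ^+ q) : a b / a - b}.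
Proof. by move=> a b; have := exprBqi 1 a b; rewrite expn1. Qed.

Lemma expr_sumq (I : Type) (r : seq I) (P : pred I) (F : I -> R) :
  (\sum_(i <- r | P i) F i) ^+ q = \sum_(i <- r | P i) F i ^+ q.
Proof.
apply: (big_morph _ exprDq).
by have := expr0qi 1; rewrite expn1.
Qed.

Lemma trqS n (a : R) : trq n.+1 q a = trq n q a + a ^+ (q ^ n).
Proof. by rewrite /trq big_ord_recr. Qed.

Lemma trq0n (a : R) : trq 0 q a = 0.
Proof. by rewrite /trq big_ord0. Qed.

Lemma trqD n : {morph trq n q : a b / a + b : R}.
Proof.
by move=> a b; rewrite /trq -big_split; apply: eq_bigr => i _; apply: exprDqi.
Qed.

Lemma trqN n (a : R) : trq n q (- a) = - trq n q a.
Proof. by rewrite /trq -sumrN; apply: eq_bigr => i _; apply: exprNqi. Qed.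

Lemma trqB n : {morph trq n q : a b / a - b : R}.
Proof. by move=> a b; rewrite trqD trqN. Qed.

Lemma trq_expq n (a : R) : trq n q a ^+ q = trq n.+1 q a - a.
Proof.
rewrite /trq expr_sumq big_ord_recl expr1 addrC addKr.
by apply: eq_bigr => i _; rewrite -exprM -expnSr.
Qed.

Lemma s2S n (a : R) : s2 n.+1 q a = s2 n q a + trq n q a * a ^+ (q ^ n).
Proof.
rewrite /s2 big_ord_recr; congr (_ + _).
by rewrite /trq mulr_suml; apply: eq_bigr => j _; rewrite exprD.
Qed.

Lemma s20 (a : R) : s2 0 q a = 0.
Proof. by rewrite /s2 big_ord0. Qed.

(** The mixed terms of the second symmetric polynomial form the product of the two traces without
    its diagonal, which is the trace of [a * b]. *)
Lemma s2D n (a b : R) :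
  s2 n q (a + b) = s2 n q a + s2 n q b + trq n q a * trq n q b - trq n q (a * b).
Proof.
elim: n => [|n IHn]; first by rewrite !s20 !trq0n; ring.
by rewrite !s2S !trqS IHn trqD exprDqi exprMn; ring.
Qed.

(** The q-th power shifts the conjugates by one: what remains of the pairs among n+1 conjugates are
    those that do not involve [a] itself. *)
Lemma s2_expq n (a : R) :
  s2 n q a ^+ q = s2 n.+1 q a - a * (trq n.+1 q a - a).
Proof.
have q0 : (0 : R) ^+ q = 0 by have := expr0qi 1; rewrite expn1.
elim: n => [|n IHn]; first by rewrite s2S !trqS s20 trq0n q0 expr1; ring.
by rewrite s2S exprDq IHn exprMn trq_expq -exprM -expnSr !(s2S, trqS); ring.
Qed.

Lemma expqi_fixed i (c : R) : c ^+ q = c -> c ^+ (q ^ i) = c.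
Proof. by move=> cq; elim: i => // i IHi; rewrite expnS exprM cq. Qed.

Lemma trq_mul_fixed n (a c : R) : c ^+ q = c -> trq n q (a * c) = trq n q a * c.
Proof.
move=> cq; rewrite /trq mulr_suml; apply: eq_bigr => i _.
by rewrite exprMn (expqi_fixed _ cq).
Qed.

Lemma s2_0 n : s2 n q (0 : R) = 0.
Proof.
by rewrite /s2 big1 // => k _; rewrite big1 // => j _; rewrite exprD expr0qi mul0r.
Qed.

Lemma s2N n (a : R) : s2 n q (- a) = trq n q a ^+ 2 - trq n q (a * a) - s2 n q a.
Proof.
rewrite -[LHS]subr0 -(s2_0 n) -(subrr a) s2D mulrN !trqN; ring.
Qed.

(** Serves twice: in K it gives closure under the group law, in E it shows that the images of x and
    y satisfy the curve equation. The first premise allows [trq n q t] to be pulled out of a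
    trace. *)
Lemma trq_shift n (a b t d : R) : trq n q t ^+ q = trq n q t ->
  trq n q b = s2 n q a -> trq n q d = s2 n q t ->
  trq n q (b + a * (trq n q t - t) + d) = s2 n q (a + t).
Proof.
move=> tF Eb Ed; rewrite s2D -Eb -Ed !trqD mulrBr trqB (trq_mul_fixed _ _ tF); ring.
Qed.

Lemma sum_trq n (a : R) : (0 < n)%N ->
  \sum_(1 <= i < n) a ^+ (q ^ i) = trq n q a - a.
Proof.
move=> n0; rewrite /trq -(big_mkord xpredT (fun i => a ^+ (q ^ i))).
by rewrite big_ltn // expr1 addrAC subrr add0r.
Qed.

Section Uniformizer.
Variables (x h : R).
Let w := h - h ^+ q + x.

Lemma trq_unif n : trq n q w = h - h ^+ (q ^ n) + trq n q x.
Proof.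
elim: n => [|n IHn]; first by rewrite !trq0n expr1; ring.
rewrite !trqS IHn /w exprDqi exprBqi -exprM -expnS; ring.
Qed.

(** This identity is the reason for the choice of [w]. By telescoping, h^(q^i) = h + Tr_i(x) -
    Tr_i(w), where Tr_i sums the first i conjugates, and the products x^(q^i) Tr_i(x) add up to
    [s2 n q x]. On the curve y = xh this term cancels against the right-hand side of the
    equation. *)
Lemma trq_mul_x n : trq n q (x * h) =
  h * trq n q x + s2 n q x - \sum_(i < n) x ^+ (q ^ i) * trq i q w.
Proof.
elim: n => [|n IHn]; first by rewrite !trq0n s20 big_ord0; ring.
by rewrite !trqS s2S IHn big_ord_recr /= trq_unif exprMn; ring.
Qed.

(* For n one less than in the equation of the curve, D turns out to be integral
   at infinity, so that w^(q^n) ~ x there. *)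
Lemma unif_pow n :
  let D := h - trq n q w in w ^+ (q ^ n) = x - D ^+ q + D.
Proof.
by rewrite /= exprBq trq_expq trqS /w; ring.
Qed.

End Uniformizer.

End FrobeniusIdentities.


(** The clause [z != 0] excludes 0, whose inverse is 0 by convention and so lies in [O]. *)
Definition place_unit (E : fieldType) (O : E -> Prop) (z : E) :=
  [/\ O z, O z^-1 & z != 0].

Lemma expr_ratio (E : fieldType) (x : E) i j : x != 0 -> (i <= j)%N ->
  x ^+ i / x ^+ j = x^-1 ^+ (j - i).
Proof.
by move=> x0 ij; rewrite exprB ?unitfE ?invr_eq0 // !exprVn invrK mulrC.
Qed.

(** * Arithmetic of a valuation ring and its maximal ideal *)

Section Places.
Variables (K E : fieldType) (iota : {rmorphism K -> E}) (O : E -> Prop).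
Hypothesis HO : is_place iota O.
Notation P := (place_ideal O).
Notation U := (place_unit O).

Lemma place1 : O 1. Proof. by case: HO => [[]]. Qed.

Lemma placeB a b : O a -> O b -> O (a - b).
Proof. by case: HO => [[_ OB _ _] _]; apply: OB. Qed.

Lemma placeM a b : O a -> O b -> O (a * b).
Proof. by case: HO => [[_ _ OM _] _]; apply: OM. Qed.

Lemma place_iota c : O (iota c). Proof. by case: HO => [[]]. Qed.

Lemma place_total z : z != 0 -> O z \/ O z^-1.
Proof. by case: HO => [_ [_ OV]]; apply: OV. Qed.

Lemma place0 : O 0.
Proof. by rewrite -(subrr 1); apply: placeB; apply: place1. Qed.

Lemma placeV z : ~ O z -> O z^-1.
Proof.
move=> Nz; have z0 : z != 0 by apply/eqP => z0; apply: Nz; rewrite z0; apply: place0.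
by case: (place_total z0).
Qed.

Lemma placeN a : O a -> O (- a).
Proof. by rewrite -sub0r; apply: placeB place0. Qed.

Lemma placeD a b : O a -> O b -> O (a + b).
Proof. by move=> Oa /placeN Ob; rewrite -[b]opprK; apply: placeB. Qed.

Lemma placeX a k : O a -> O (a ^+ k).
Proof.
by move=> Oa; elim: k => [|k IHk]; rewrite ?exprS; [apply: place1 | apply: placeM].
Qed.

Lemma place_sum (I : Type) (r : seq I) (Q : pred I) (F : I -> E) :
  (forall i, Q i -> O (F i)) -> O (\sum_(i <- r | Q i) F i).
Proof. by move=> OF; apply: big_ind => //; [apply: place0 | apply: placeD]. Qed.

Lemma place_idealW a : P a -> O a. Proof. by case. Qed.

Lemma place_ideal0 : P 0. Proof. by split; [apply: place0 | left]. Qed.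

Lemma place_idealM a b : O a -> P b -> P (a * b).
Proof.
move=> Oa [Ob Pb]; split; first exact: placeM.
have [-> | a0] := eqVneq a 0; first by left; rewrite mul0r.
case: Pb => [-> | Pb]; [by left; rewrite mulr0 | right => Oab; apply: Pb].
by rewrite -[b^-1](mulKf a0) mulrCA -invfM; apply: placeM.
Qed.

Lemma place_idealV z : ~ O z -> P z^-1.
Proof. by move=> Nz; split; [apply: placeV | right; rewrite invrK]. Qed.

(** Of two nonzero elements one divides the other in [O], so their difference is an [O]-multiple of
    one of them. *)
Lemma place_idealB a b : P a -> P b -> P (a - b).
Proof.
move=> Pa Pb.
have PN c : P c -> P (- c).
  by move=> Pc; rewrite -mulN1r; apply: place_idealM => //; apply/placeN/place1.
have [-> | a0] := eqVneq a 0; first by rewrite sub0r; apply: PN.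
have [-> | b0] := eqVneq b 0; first by rewrite subr0.
have ab0 : a / b != 0 by rewrite mulf_neq0 ?invr_eq0.
case: (place_total ab0) => Oab.
  have ->: a - b = (a / b - 1) * b by rewrite mulrBl mul1r divfK.
  by apply: place_idealM => //; apply: placeB Oab place1.
have ->: a - b = (1 - (a / b)^-1) * a by rewrite mulrBl mul1r invf_div divfK.
by apply: place_idealM => //; apply: placeB place1 Oab.
Qed.

Lemma place_idealN a : P a -> P (- a).
Proof. by rewrite -sub0r; apply: place_idealB place_ideal0. Qed.

Lemma place_idealD a b : P a -> P b -> P (a + b).
Proof. by move=> Pa /place_idealN Pb; rewrite -[b]opprK; apply: place_idealB. Qed.

Lemma place_ideal_sum (I : Type) (r : seq I) (Q : pred I) (F : I -> E) :
  (forall i, Q i -> P (F i)) -> P (\sum_(i <- r | Q i) F i).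
Proof.
by move=> PF; apply: big_ind => //; [apply: place_ideal0 | apply: place_idealD].
Qed.

Lemma place_idealX a k : P a -> (0 < k)%N -> P (a ^+ k).
Proof.
move=> Pa; case: k => // k _; rewrite exprSr.
by apply: place_idealM => //; apply/placeX/place_idealW.
Qed.

Lemma place_unitP z : O z -> ~ P z -> U z.
Proof.
move=> Oz NP; have z0 : z != 0.
  by apply/eqP => z0; apply: NP; rewrite z0; apply: place_ideal0.
by split=> //; apply: boolp.contrapT => NOz; apply: NP; split=> //; right.
Qed.

Lemma place_unit_notP z : U z -> ~ P z.
Proof. by case=> Oz OV z0 [_ [/eqP|//]]; apply/negP. Qed.

Lemma place_unitD u a : U u -> P a -> U (u + a).
Proof.
move=> Uu Pa; apply: place_unitP.
  by apply: placeD; [case: Uu | apply: place_idealW].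
move=> /place_idealB/(_ Pa); rewrite addrK; exact: place_unit_notP.
Qed.

Lemma place_unit1 : U 1.
Proof. by split; rewrite ?invr1 ?oner_eq0; try apply: place1. Qed.

Lemma place_unitM u v : U u -> U v -> U (u * v).
Proof.
case=> Ou Ou' u0 [Ov Ov' v0].
by split; rewrite ?invfM ?mulf_neq0 //; apply: placeM.
Qed.

Lemma place_unitV u : U u -> U u^-1.
Proof. by case=> Ou Ou' u0; split; rewrite ?invrK ?invr_eq0. Qed.

Lemma place_unitX u k : U u -> U (u ^+ k).
Proof.
move=> Uu; elim: k => [|k IHk]; rewrite ?expr0 ?exprS; first exact: place_unit1.
exact: place_unitM.
Qed.

Lemma place_unit_iota c : c != 0 -> U (iota c).
Proof.
by move=> c0; split; rewrite -?fmorphV ?fmorph_eq0 //; apply: place_iota.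
Qed.

Lemma place_ideal_iota c : P (iota c) -> c = 0.
Proof.
by move=> Pc; apply/eqP/negP => /negP/place_unit_iota/place_unit_notP.
Qed.

(** Valuation rings are integrally closed: if z were outside [O], division by z^(N-1) would express
    z through z^-1, which lies in [O]. The exponents [e] are arbitrary so that the additive
    polynomials of the curve fit without rewriting. *)
Lemma place_integral (I : finType) (c : I -> E) (e : I -> nat) N z :
  (0 < N)%N -> (forall i, O (c i)) -> (forall i, (e i < N)%N) ->
  O (z ^+ N + \sum_i c i * z ^+ e i) -> O z.
Proof.
case: N => // N _ Oc eN Os; have {}eN i : (e i <= N)%N := eN i.
apply: boolp.contrapT => NOz; apply: (NOz).
have z0 : z != 0 by apply/eqP => z0; apply: NOz; rewrite z0; apply: place0.
have OV := placeV NOz.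
set s := _ + _ in Os.
have ->: z = s * z^-1 ^+ N - \sum_i c i * z^-1 ^+ (N - e i).
  rewrite /s mulrDl exprS exprVn mulfK ?expf_neq0 // mulr_suml -addrA -sumrB.
  rewrite big1 ?addr0 // => i _; rewrite (exprB (eN i)) ?unitfE ?invr_eq0 //.
  by rewrite !exprVn invrK [_^-1 * _]mulrC mulrA subrr.
apply: placeB; first by apply: placeM => //; apply: placeX.
by apply: place_sum => i _; apply: placeM => //; apply: placeX.
Qed.

Lemma place_root z k : (0 < k)%N -> O (z ^+ k) -> O z.
Proof.
move=> k0 Oz; apply: (@place_integral 'I_0 (fun=> 0) (fun=> 0%N) k) => //.
  by move=> _; apply: place0.
by rewrite big_ord0 addr0.
Qed.

End Places.


(** * Evaluation of polynomials as ring morphisms *)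

Section Evaluation.
Variables (K E : fieldType) (iota : {rmorphism K -> E}).

Lemma ev1_is_zmod_morphism x : zmod_morphism (ev1 iota x).
Proof. by move=> p r; rewrite /ev1 rmorphB hornerD hornerN. Qed.

Lemma ev1_is_monoid_morphism x : monoid_morphism (ev1 iota x).
Proof.
by split=> [|p r]; rewrite /ev1 ?rmorph1 ?hornerC // rmorphM hornerM.
Qed.

HB.instance Definition _ x :=
  GRing.isZmodMorphism.Build {poly K} E (ev1 iota x) (ev1_is_zmod_morphism x).
HB.instance Definition _ x :=
  GRing.isMonoidMorphism.Build {poly K} E (ev1 iota x)
    (ev1_is_monoid_morphism x).

Lemma ev2_is_zmod_morphism x y : zmod_morphism (ev2 iota x y).
Proof. by move=> p r; rewrite /ev2 rmorphB hornerD hornerN. Qed.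

Lemma ev2_is_monoid_morphism x y : monoid_morphism (ev2 iota x y).
Proof.
by split=> [|p r]; rewrite /ev2 ?rmorph1 ?hornerC // rmorphM hornerM.
Qed.

HB.instance Definition _ x y :=
  GRing.isZmodMorphism.Build {poly {poly K}} E (ev2 iota x y)
    (ev2_is_zmod_morphism x y).
HB.instance Definition _ x y :=
  GRing.isMonoidMorphism.Build {poly {poly K}} E (ev2 iota x y)
    (ev2_is_monoid_morphism x y).

Lemma ev2D x y P Q : ev2 iota x y (P + Q) = ev2 iota x y P + ev2 iota x y Q.
Proof. exact: rmorphD. Qed.
Lemma ev2B x y P Q : ev2 iota x y (P - Q) = ev2 iota x y P - ev2 iota x y Q.
Proof. exact: rmorphB. Qed.
Lemma ev2M x y P Q : ev2 iota x y (P * Q) = ev2 iota x y P * ev2 iota x y Q.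
Proof. exact: rmorphM. Qed.
Lemma ev2_0 x y : ev2 iota x y 0 = 0. Proof. exact: rmorph0. Qed.
Lemma ev2_1 x y : ev2 iota x y 1 = 1. Proof. exact: rmorph1. Qed.
Lemma ev1C x c : ev1 iota x c%:P = iota c.
Proof. by rewrite /ev1 map_polyC hornerC. Qed.
Lemma ev1X x : ev1 iota x 'X = x.
Proof. by rewrite /ev1 map_polyX hornerX. Qed.
Lemma ev2C x y p : ev2 iota x y p%:P = ev1 iota x p.
Proof. by rewrite /ev2 map_polyC hornerC. Qed.
Lemma ev2X x y : ev2 iota x y 'X = y.
Proof. by rewrite /ev2 map_polyX hornerX. Qed.

Lemma ev1E x p : ev1 iota x p = \sum_(i < size p) iota p`_i * x ^+ i.
Proof.
rewrite /ev1 (@horner_coef_wide _ (size p)) ?size_map_poly //.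
by apply: eq_bigr => i _; rewrite coef_map.
Qed.

Lemma ev2E k x y (P : {poly {poly K}}) : (size P <= k)%N ->
  ev2 iota x y P = \sum_(i < k) ev1 iota x P`_i * y ^+ i.
Proof.
move=> Pk; rewrite /ev2 (@horner_coef_wide _ k).
  by apply: eq_bigr => i _; rewrite coef_map.
by rewrite (leq_trans (size_poly _ _)).
Qed.

End Evaluation.

(** * Pole orders of y and w where x has a pole *)

Section InfinitePlaces.
Variables (K E : fieldType) (iota : {rmorphism K -> E}).
Variables (q n' : nat) (x y : E).
Hypothesis q_gt1 : (1 < q)%N.
Hypothesis n'_gt0 : (0 < n')%N.
Hypothesis exprDq : {morph (fun z : E => z ^+ q) : a b / a + b}.
Hypothesis Hy : trq n'.+1 q y = s2 n'.+1 q x.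
Let h := y / x.
Let w := h - h ^+ q + x.
Let N := (q ^ n')%N.

Section OnePlace.
Variable O : E -> Prop.
Hypotheses (HO : is_place iota O) (Ox : ~ O x).
Notation P := (place_ideal O).
Notation U := (place_unit O).
(** Says that the pole order of z is at most k times that of x, without a numerical valuation. *)
Let bd k z := O (z / x ^+ k).

Let x0 : x != 0.
Proof. by apply/eqP => x0; apply: Ox; rewrite x0; apply: place0 HO. Qed.
Let OVx : O x^-1. Proof. exact: (placeV HO). Qed.
Let q_gt0 : (0 < q)%N. Proof. exact: ltnW. Qed.

Let bdD k a b : bd k a -> bd k b -> bd k (a + b).
Proof. by move=> ba bb; rewrite /bd mulrDl; apply: (placeD HO). Qed.
Let bdB k a b : bd k a -> bd k b -> bd k (a - b).
Proof. by move=> ba bb; rewrite /bd mulrBl; apply: (placeB HO). Qed.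
Let bdM k l a b : bd k a -> bd l b -> bd (k + l) (a * b).
Proof. by move=> ba bb; rewrite /bd exprD invfM mulrACA; apply: (placeM HO). Qed.
Let bdW k l a : (k <= l)%N -> bd k a -> bd l a.
Proof.
move=> kl ba; rewrite /bd -(subnK kl) exprD invfM mulrCA.
by apply: (placeM HO) => //; rewrite -exprVn; apply: (placeX HO).
Qed.
Let bdx k : bd k (x ^+ k).
Proof. by rewrite /bd divff ?expf_neq0 //; apply: (place1 HO). Qed.
Let bdX k i a : bd k a -> bd (k * i) (a ^+ i).
Proof. by move=> ba; rewrite /bd exprM -expr_div_n; apply: (placeX HO). Qed.
Let bd_root k i a : (0 < i)%N -> bd (k * i) (a ^+ i) -> bd k a.
Proof. by move=> i0; rewrite /bd exprM -expr_div_n; apply: (place_root HO). Qed.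
Let bd_sum k m (F : nat -> E) : (forall i, (i < m)%N -> bd k (F i)) -> bd k (\sum_(i < m) F i).
Proof.
by move=> bF; rewrite /bd mulr_suml; apply: (place_sum HO) => i _; apply: bF.
Qed.

Let q_exp i j : (i <= j)%N -> (q ^ i <= q ^ j)%N.
Proof. by move=> ij; rewrite leq_exp2l. Qed.
Let q_gt0i i : (0 < q ^ i)%N. Proof. by rewrite expn_gt0 q_gt0. Qed.

Let bd_trq i z : bd q z -> bd (q ^ i) (trq i q z).
Proof.
move=> bz; apply: (@bd_sum _ _ (fun j => z ^+ (q ^ j))) => j ji.
by apply: bdW (bdX (q ^ j) bz); rewrite -expnS q_exp.
Qed.

Let bd_trq1 i z : bd 1 z -> bd (q ^ i.-1) (trq i q z).
Proof.
move=> bz; apply: (@bd_sum _ _ (fun j => z ^+ (q ^ j))) => j ji.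
by apply: bdW (bdX (q ^ j) bz); rewrite mul1n q_exp //; case: (i) ji.
Qed.

(** Divided by x^(2N), the curve equation becomes monic in y/x^2 with integral coefficients, since
    every exponent q^j + q^k in [s2] is at most 2N. *)
Lemma inf_y : O (y / x ^+ 2).
Proof.
pose c (i : 'I_n') := (x ^+ 2) ^+ (q ^ i) / (x ^+ 2) ^+ N.
have c_in i : O (c i).
  rewrite /c -!exprM; apply: (bdW _ (bdx _)).
  by rewrite leq_mul2l /= q_exp // ltnW.
apply: (place_integral HO (c := c) (e := fun i : 'I_n' => (q ^ i)%N) (N := N)) => //.
- exact: q_gt0i.
- by move=> i; rewrite ltn_exp2l.
have ->: (y / x ^+ 2) ^+ N + \sum_i c i * (y / x ^+ 2) ^+ (q ^ i)
         = trq n'.+1 q y / (x ^+ 2) ^+ N.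
  rewrite trqS mulrDl addrC expr_div_n; congr (_ + _).
  rewrite /trq mulr_suml; apply: eq_bigr => i _; rewrite /c expr_div_n.
  by field; rewrite !expf_neq0.
rewrite Hy -exprM; apply: (@bd_sum _ _ (fun k => \sum_(j < k) x ^+ (q ^ j + q ^ k))) => k kn.
apply: (@bd_sum _ _ (fun j => x ^+ (q ^ j + q ^ k))) => j jk.
apply: bdW (bdx _); rewrite mul2n -addnn leq_add ?q_exp //.
by rewrite (leq_trans (ltnW jk)).
Qed.

Let bd_h : bd 1 h.
Proof. by rewrite /bd /h expr1 -mulrA -invfM; apply: inf_y. Qed.

Lemma unit_trqx : U (trq n'.+1 q x / x ^+ N).
Proof.
rewrite trqS addrC mulrDl divff ?expf_neq0 //.
apply: (place_unitD HO); first exact: (place_unit1 HO).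
rewrite /trq mulr_suml; apply: (place_ideal_sum HO) => i _.
have iN : (q ^ i < N)%N by rewrite ltn_exp2l.
rewrite -(subnK (ltnW iN)) exprD invfM mulrCA divff ?expf_neq0 // mulr1.
rewrite -exprVn; apply: (place_idealX HO); last by rewrite subn_gt0.
exact: (place_idealV HO).
Qed.

Let D := h - trq n' q w.

(** Subtracting [trq n' q w] from [h] cancels the summand i = n', the only one with the factor x^N.
    Since Tr(x) has the size of x^N, this is what makes [D] small. *)
Let D_trqx : D * trq n'.+1 q x
  = \sum_(i < n') x ^+ (q ^ i) * (trq i q w - trq n' q w).
Proof.
have hT : h * trq n'.+1 q x = \sum_(i < n'.+1) x ^+ (q ^ i) * trq i q w.
  have := trq_mul_x q_gt0 exprDq x h n'.+1.
  rewrite [x * h]mulrC divfK // Hy -/w => /eqP.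
  by rewrite -addrA eq_sym addrCA -subr_eq0 addrAC subrr add0r subr_eq0 => /eqP.
under eq_bigr => i _ do rewrite mulrBr.
rewrite sumrB -mulr_suml mulrBl hT big_ord_recr trqS /= /trq; ring.
Qed.

Let bd_D k l : (l <= k + N)%N ->
  (forall i, (i < n')%N -> bd l (x ^+ (q ^ i) * (trq i q w - trq n' q w))) ->
  bd k D.
Proof.
move=> lkN bdt; have bDT : bd (k + N) (D * trq n'.+1 q x).
  apply: (bdW lkN); rewrite D_trqx.
  exact: (@bd_sum _ _ (fun i => x ^+ (q ^ i) * (trq i q w - trq n' q w))).
have [_ OV T0] := unit_trqx.
have T0' : trq n'.+1 q x != 0.
  by apply: contraNneq T0 => ->; rewrite mul0r.
rewrite /bd; have ->: D / x ^+ k =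
    (D * trq n'.+1 q x / x ^+ (k + N)) * (trq n'.+1 q x / x ^+ N)^-1.
  by rewrite exprD; field; rewrite T0' !expf_neq0.
exact: (placeM HO).
Qed.

Lemma inf_w : U (w ^+ N / x).
Proof.
have q1N : (q ^ n'.-1 * q = N)%N by rewrite -expnSr prednK.
have le1 i : (i < n')%N -> (q ^ i <= q ^ n'.-1)%N.
  by move=> iN; rewrite q_exp // -ltnS prednK.
have bdx1 : bd 1 x by rewrite /bd expr1 divff //; apply: (place1 HO).
have wN : w ^+ N = x - D ^+ q + D by apply: unif_pow.
(* First round: the crude bound q for [w] yields the bound q^(n'-1) for [D], and the formula for w^N
   turns this into the sharp bound 1 for [w]. *)
have bd1w : bd 1 w.
  have bw : bd q w.
    apply: bdD; last exact: (bdW q_gt0 bdx1).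
    apply: bdB; first exact: (bdW q_gt0 bd_h).
    by rewrite -[q in bd q]mul1n; apply: bdX.
  have bD : bd (q ^ n'.-1) D.
    apply: (@bd_D _ (q ^ n'.-1 + N)) => // i iN.
    apply: bdM; first by apply: bdW (bdx _); apply: le1.
    apply: bdB; last exact: bd_trq.
    by apply: bdW (bd_trq _ bw); rewrite q_exp // ltnW.
  apply: (@bd_root _ N _ (q_gt0i n')); rewrite mul1n wN.
  apply: bdD; first apply: bdB.
  - exact: (bdW (q_gt0i n') bdx1).
  - by rewrite -q1N; apply: bdX.
  - by apply: bdW bD; rewrite q_exp // leq_pred.
(* Second round: with the sharp bound for [w], each summand of [D_trqx] is bounded by 2 q^(n'-1),
   which is at most N because q is at least 2. *)
have OD : O D.
  have: bd 0 D; last by rewrite /bd divr1.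
  apply: (@bd_D _ (q ^ n'.-1 + q ^ n'.-1)) => [|i iN].
    by rewrite add0n addnn -q1N mulnC -mul2n leq_mul2r q_gt1 orbT.
  apply: bdM; first by apply: bdW (bdx _); apply: le1.
  apply: bdB; last exact: bd_trq1.
  by apply: bdW (bd_trq1 _ bd1w); rewrite le1 // (leq_ltn_trans _ iN) ?leq_pred.
rewrite wN -addrA mulrDl divff //.
apply: (place_unitD HO); first exact: (place_unit1 HO).
apply: (place_idealM HO); last exact: (place_idealV HO).
rewrite addrC; apply: (placeB HO) => //; exact: (placeX HO).
Qed.
End OnePlace.
End InfinitePlaces.


(** * Dominant terms of polynomials in x and w at infinity *)

Section LeadingTerm.
Variables (K E : fieldType) (iota : {rmorphism K -> E}).

Lemma inf_unit_ev1 (O : E -> Prop) x p : is_place iota O -> ~ O x -> p != 0 ->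
  place_unit O (ev1 iota x p / x ^+ (size p).-1).
Proof.
move=> HO Ox p0.
have x0 : x != 0 by apply/eqP => x0; apply: Ox; rewrite x0; apply: place0 HO.
have sp : size p = (size p).-1.+1 by rewrite prednK ?size_poly_gt0.
rewrite ev1E sp big_ord_recr /= addrC mulrDl mulfK ?expf_neq0 //.
apply: (place_unitD HO).
  by apply: (place_unit_iota HO); rewrite -lead_coefE lead_coef_eq0.
rewrite mulr_suml; apply: (place_ideal_sum HO) => i _.
rewrite -mulrA; apply: (place_idealM HO); first exact: (place_iota HO).
rewrite expr_ratio ?(ltnW (ltn_ord i)) //.
apply: (place_idealX HO); last by rewrite subn_gt0.
exact: (place_idealV HO).
Qed.

Variables (N : nat) (x w : E).
Hypothesis N_gt0 : (0 < N)%N.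
Hypothesis Hxw : forall O, is_place iota O -> ~ O x -> place_unit O (w ^+ N / x).

(* The monomials x^i w^j with j < N have pairwise distinct pole orders
   N i + j, so the largest one dominates. *)
Lemma inf_unit_sum (F : nat -> {poly K}) k : (k <= N)%N ->
  (forall j, (j < k)%N -> F j = 0) \/
  exists M, (M %% N < k)%N /\ forall O, is_place iota O -> ~ O x ->
     place_unit O ((\sum_(j < k) ev1 iota x (F j) * w ^+ j) / w ^+ M).
Proof.
elim: k => [|k IHk] kN; first by left.
have hw O : is_place iota O -> ~ O x -> w != 0 /\ place_ideal O w^-1.
  move=> HO Ox; have [O1 O2 /eqP w0] := Hxw HO Ox.
  have w0' : w != 0.
    by apply/eqP => w00; apply: w0; rewrite w00 expr0n -[N]prednK // mul0r.
  split=> //; apply: (place_idealV HO) => Ow; apply: Ox.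
  have x0 : x != 0 by apply/eqP => x0; apply: w0; rewrite x0 invr0 mulr0.
  have -> : x = (w ^+ N / x)^-1 * w ^+ N.
    by rewrite invf_div divfK ?expf_neq0.
  by apply: (placeM HO) => //; apply: (placeX HO).
have new : F k != 0 -> forall O, is_place iota O -> ~ O x ->
    place_unit O ((ev1 iota x (F k) * w ^+ k) / w ^+ (N * (size (F k)).-1 + k)).
  move=> Fk O HO Ox; have [w0 _] := hw O HO Ox.
  have u1 := inf_unit_ev1 HO Ox Fk.
  have u2 := place_unitV (place_unitX HO (size (F k)).-1 (Hxw HO Ox)).
  have x0 : x != 0 by apply/eqP => x0; apply: Ox; rewrite x0; apply: place0 HO.
  have -> : ev1 iota x (F k) * w ^+ k / w ^+ (N * (size (F k)).-1 + k) =
     (ev1 iota x (F k) / x ^+ (size (F k)).-1) * ((w ^+ N / x) ^+ (size (F k)).-1)^-1.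
    rewrite exprD exprM expr_div_n; field.
    by rewrite !expf_neq0.
  exact: (place_unitM HO).
have [|IH0|[M [Mk IHM]]] := IHk; first exact: ltnW.
  have [Fk|Fk] := eqVneq (F k) 0.
    by left=> j; rewrite ltnS leq_eqVlt => /predU1P[-> //|]; apply: IH0.
  right; exists (N * (size (F k)).-1 + k)%N; split.
    by rewrite mulnC modnMDl modn_small.
  move=> O HO Ox; rewrite big_ord_recr big1 /= ?add0r; first exact: new.
  by move=> j _; rewrite IH0 // rmorph0 mul0r.
right; have [Fk|Fk] := eqVneq (F k) 0.
  exists M; split; first exact: leqW.
  by move=> O HO Ox; rewrite big_ord_recr /= Fk rmorph0 mul0r addr0; apply: IHM.
set M' := (N * (size (F k)).-1 + k)%N.
have M'k : (M' %% N = k)%N by rewrite /M' mulnC modnMDl modn_small.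
have dom O a b m m' : is_place iota O -> ~ O x -> (m' < m)%N ->
    place_unit O (a / w ^+ m) -> place_unit O (b / w ^+ m') ->
    place_unit O ((a + b) / w ^+ m).
  move=> HO Ox mm Ua Ub; rewrite mulrDl; apply: (place_unitD HO) => //.
  have [w0 Pw] := hw O HO Ox.
  rewrite -(subnK (ltnW mm)) exprD invfM mulrCA mulrC.
  apply: (place_idealM HO); first by case: Ub.
  by rewrite -exprVn; apply: (place_idealX HO); rewrite // subn_gt0.
(* Modulo N the exponent [M] is below k while [M'] is k, so they differ and one term strictly
   dominates. *)
case: (ltngtP M M') => [MM|MM|MM].
- exists M'; rewrite M'k; split=> // O HO Ox; rewrite big_ord_recr /= addrC.
  by apply: (dom O _ _ M' M) => //; [apply: new | apply: IHM].
- exists M; split; first exact: leqW.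
  move=> O HO Ox; rewrite big_ord_recr /=.
  by apply: (dom O _ _ M M') => //; [apply: IHM | apply: new].
- by move: Mk; rewrite MM M'k ltnn.
Qed.

(** The exponent [M] is chosen before the place, which is what allows two places at infinity to be
    compared. *)
Lemma inf_unit_ev2 (P : {poly {poly K}}) : (size P <= N)%N -> P != 0 ->
  exists M, forall O, is_place iota O -> ~ O x ->
     place_unit O (ev2 iota x w P / w ^+ M).
Proof.
move=> sP P0; have [P00|[M [_ HM]]] := inf_unit_sum (fun j => P`_j) (leqnn N).
  case/eqP: P0; apply/polyP => i; rewrite coef0.
  by case: (ltnP i N) => iN; [apply: P00 | rewrite nth_default // (leq_trans sP)].
by exists M => O HO Ox; rewrite (ev2E _ _ _ sP); apply: HM.
Qed.

End LeadingTerm.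


(** * Existence of a place where x has a pole *)

Lemma sum_expr_rev (E : fieldType) (c : nat -> E) (z : E) k : z != 0 ->
  \sum_(i < k.+1) c (k - i)%N * z ^+ i
    = z ^+ k * \sum_(i < k.+1) c i * z^-1 ^+ i.
Proof.
move=> z0; rewrite (reindex_inj rev_ord_inj) mulr_sumr; apply: eq_bigr => i _ /=.
rewrite subSS subKn -1?ltnS // mulrCA; congr (_ * _).
by rewrite exprB ?unitfE // ?exprVn // -ltnS.
Qed.

Section PlaceExistence.
Variables (K E : fieldType) (iota : {rmorphism K -> E}) (x : E).

(** Containing x^-1 but not x means that x^-1 is a non-unit of [A]. Maximal rings of this kind are
    valuation rings, as in Chevalley's extension theorem. *)
Definition subring_avoiding (A : E -> Prop) :=
  [/\ [/\ A 1, (forall a b, A a -> A b -> A (a - b)),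
      (forall a b, A a -> A b -> A (a * b)) & (forall c, A (iota c))],
     A x^-1 & ~ A x].

Lemma subring_avoiding_base : transcendental iota x ->
  subring_avoiding (fun z => exists p, z = ev1 iota x^-1 p).
Proof.
move=> Hx.
have x0 : x != 0 by have := Hx 'X; rewrite polyX_eq0 map_polyX hornerX => /(_ isT).
split; last 2 first.
- by exists 'X; rewrite ev1X.
- case=> p xp; pose d := size p.
  (* The relation x = p(x^-1), multiplied by x^d, reads r(x) = 0. *)
  pose r := 'X^(d.+1) - \poly_(j < d.+1) p`_(d - j).
  have r0 : r != 0.
    rewrite subr_eq0; apply/eqP => /(congr1 (fun r : {poly K} => size r)).
    by rewrite size_polyXn => sr; have := size_poly d.+1 (fun j => p`_(d - j)); rewrite -sr ltnn.
  have: ev1 iota x r != 0 := Hx r r0; rewrite rmorphB rmorphXn /= ev1X.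
  rewrite poly_def rmorph_sum /=.
  under eq_bigr => i _ do rewrite -mul_polyC rmorphM rmorphXn /= ev1C ev1X.
  rewrite (sum_expr_rev (fun i => iota p`_i)) // big_ord_recr /= nth_default //.
  by rewrite rmorph0 mul0r addr0 -ev1E -xp exprSr subrr eqxx.
split.
- by exists 1; rewrite rmorph1.
- by move=> _ _ [p ->] [r ->]; exists (p - r); rewrite rmorphB.
- by move=> _ _ [p ->] [r ->]; exists (p * r); rewrite rmorphM.
- by move=> c; exists c%:P; rewrite ev1C.
Qed.

Lemma subring_avoiding_max : transcendental iota x ->
  exists2 A, subring_avoiding A &
    forall B, subring_avoiding B -> (forall z, A z -> B z) -> forall z, B z -> A z.
Proof.
move=> /subring_avoiding_base base.
(* Zorn's lemma is applied to unions of chains, including the empty chain; quantifying over an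
   element of [A] lets the empty set satisfy [Q]. The maximal set is nonempty because the base ring
   would extend it. *)
pose Q (A : classical_sets.set E) := forall a, A a -> subring_avoiding A.
have [|A [QA maxA]] := @classical_sets.Zorn_bigcup E Q.
  move=> F FQ tot a [A FA Aa].
  have SF B b : F B -> B b -> subring_avoiding B.
    by move=> FB Bb; apply: (FQ B FB b).
  have [[A1 AB AM Ai] Ax NAx] := SF _ _ FA Aa.
  have both b c : classical_sets.bigcup F id b -> classical_sets.bigcup F id c ->
      exists2 B, F B & B b /\ B c.
    move=> [B FB Bb] [C FC Cc]; case: (tot B C FB FC) => sub.
      by exists C => //; split=> //; apply: sub.
    by exists B => //; split=> //; apply: sub.
  split; last 2 first.
  - by exists A.
  - by case=> B FB Bx; case: (SF _ _ FB Bx).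
  split.
  - by exists A.
  - move=> b c Ub Uc; have [B FB [Bb Bc]] := both b c Ub Uc.
    by exists B => //; case: (SF _ _ FB Bb) => [[_ BB _ _] _ _]; apply: BB.
  - move=> b c Ub Uc; have [B FB [Bb Bc]] := both b c Ub Uc.
    by exists B => //; case: (SF _ _ FB Bb) => [[_ _ BM _] _ _]; apply: BM.
  - by move=> c; exists A.
have maxA' B : subring_avoiding B -> (forall z, A z -> B z) -> forall z, B z -> A z.
  move=> SB AB z Bz; apply: boolp.contrapT => NAz.
  by apply: (maxA B) => [|a _ //]; split=> // BA; apply/NAz/BA.
exists A => //; apply: boolp.contrapT => NSA.
have A0 z : ~ A z by move=> Az; apply: NSA; apply: QA Az.
have [[B1 _ _ _] _ _] := base.
by apply: (A0 1); apply: (maxA' _ base) => // z /A0.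
Qed.

Section Maximal.
Variable A : E -> Prop.
Hypothesis HA : subring_avoiding A.
Hypothesis maxA :
  forall B, subring_avoiding B -> (forall z, A z -> B z) -> forall z, B z -> A z.

Let A1 : A 1. Proof. by case: HA => [[]]. Qed.
Let AB a b : A a -> A b -> A (a - b).
Proof. by case: HA => [[_ h _ _] _ _]; apply: h. Qed.
Let AM a b : A a -> A b -> A (a * b).
Proof. by case: HA => [[_ _ h _] _ _]; apply: h. Qed.
Let Ai c : A (iota c). Proof. by case: HA => [[]]. Qed.
Let At : A x^-1. Proof. by case: HA. Qed.
Let NAx : ~ A x. Proof. by case: HA. Qed.
Let A0 : A 0. Proof. by rewrite -(subrr 1); apply: AB. Qed.
Let AD a b : A a -> A b -> A (a + b).
Proof.
by move=> Aa Ab; rewrite -[b]opprK; apply: AB => //; rewrite -sub0r; apply: AB.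
Qed.
Let AX a k : A a -> A (a ^+ k).
Proof. by move=> Aa; elim: k => [|k IHk]; rewrite ?exprS //; apply: AM. Qed.
Let Asum k (F : 'I_k -> E) : (forall i, A (F i)) -> A (\sum_i F i).
Proof. by move=> AF; apply: big_ind. Qed.
Let x0 : x != 0. Proof. by apply/eqP => x0; apply: NAx; rewrite x0. Qed.

(** The ring A[u] is strictly larger than [A], so by maximality it can only fail to avoid x. *)
Lemma avoiding_adjoin u : ~ A u -> exists2 p : {poly E}, (forall i, A p`_i) & x = p.[u].
Proof.
move=> NAu; apply: boolp.contrapT => Nx; apply: NAu.
apply: (maxA (B := fun z => exists2 p : {poly E}, (forall i, A p`_i) & z = p.[u])).
- have AC c : A c -> exists2 p : {poly E}, (forall i, A p`_i) & c = p.[u].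
    by move=> Ac; exists c%:P; rewrite ?hornerC // => i; rewrite coefC; case: ifP.
  split=> //; last exact: AC.
  split; [exact: AC | | | by move=> c; apply: AC].
  + move=> _ _ [p Ap ->] [r Ar ->]; exists (p - r); last by rewrite !hornerE.
    by move=> i; rewrite coefB; apply: AB.
  + move=> _ _ [p Ap ->] [r Ar ->]; exists (p * r); last by rewrite hornerM.
    by move=> i; rewrite coefM; apply: Asum => j; apply: AM.
- by move=> z Az; exists z%:P; rewrite ?hornerC // => i; rewrite coefC; case: ifP.
- by exists 'X; rewrite ?hornerX // => i; rewrite coefX; case: eqP.
Qed.

(** The element x^-1 lies in the Jacobson radical of [A]. If u^-1 were missing, then x = p(u^-1) and
    x u^d would lie in [A] for d = [size p]; but u^d = 1 - x^-1 b with b in [A], so x = x u^d + b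
    would lie in [A] too. *)
Lemma avoiding_unit m : A m -> 1 - x^-1 * m != 0 /\ A (1 - x^-1 * m)^-1.
Proof.
move=> Am; set u := 1 - _.
have Au : A u by apply: AB => //; apply: AM.
have u0 : u != 0.
  apply/eqP => /eqP; rewrite subr_eq0 => /eqP xm; apply: NAx.
  by rewrite -[x]mulr1 xm mulVKf.
split=> //; apply: boolp.contrapT => /avoiding_adjoin[p Ap xp].
have [b Ab ub] : exists2 b, A b & u ^+ size p = 1 - x^-1 * b.
  elim: (size p) => [|k [b Ab IHk]]; first by exists 0; rewrite // mulr0 subr0.
  exists (m + b * u); first by apply: AD => //; apply: AM.
  by rewrite exprS IHk /u; ring.
have xb : x * u ^+ size p = x - b by rewrite ub mulrBr mulr1 mulVKf.
apply: NAx; rewrite -[x](subrK b) -xb; apply: AD => //.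
rewrite {1}xp (@horner_coef_wide _ (size p).+1) // mulrC -sum_expr_rev //.
by apply: Asum => i; apply: AM => //; apply: AX.
Qed.

(** If neither lies in [A], then x is a polynomial in z and one in z^-1 over [A]. Descent on the sum
    of the sizes: the one of smaller size serves to remove the leading term of the other. *)
Lemma avoiding_total z : z != 0 -> A z \/ A z^-1.
Proof.
suff main s : forall z (p r : {poly E}), z != 0 -> (size p + size r <= s)%N ->
    (forall i, A p`_i) -> (forall i, A r`_i) -> x = p.[z] -> x = r.[z^-1] -> False.
  move=> z0; apply: boolp.contrapT => NA.
  have [p Ap xp] := @avoiding_adjoin z (fun Az => NA (or_introl Az)).
  have [r Ar xr] := @avoiding_adjoin z^-1 (fun Az => NA (or_intror Az)).
  exact: (main _ z p r z0 (leqnn _)).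
elim: s => [|s IHs] {}z p r z0.
  rewrite leqn0 addn_eq0 size_poly_eq0 => /andP[/eqP-> _] _ _.
  by rewrite horner0 => xp; case/eqP: x0.
wlog rp : z p r z0 / (size r <= size p)%N.
  move=> wl sz Ap Ar xp xr; case: (leqP (size r) (size p)) => rp.
    exact: (wl z p r).
  apply: (wl z^-1 r p); rewrite ?invr_eq0 ?invrK 1?addnC //; exact: ltnW.
move=> sz Ap Ar xp xr.
have [r1|r1] := leqP (size r) 1.
  by apply: NAx; rewrite xr (size1_polyC r1) hornerC.
have [d sp] : exists d, size p = d.+2 by case: (size p) (leq_trans r1 rp) => [|[|d]] // _; exists d.
have [u0 Au] := avoiding_unit (Ar 0%N); set u := 1 - _ in u0 Au.
(* From 1 = x^-1 r(z^-1) the constant term is moved to the left and the unit [u] divided out, so 1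
   is the sum of c_j z^-j over j > 0. Multiplied by z^(d+1), this replaces the top power of z in [p]
   by lower ones. *)
pose c j := x^-1 * r`_j / u.
have Ac j : A (c j) by do 2!apply: AM => //.
pose p' := \poly_(i < d.+1) (p`_i + p`_d.+1 * c (d.+1 - i)%N).
apply: (IHs z p' r z0); rewrite //.
- by rewrite -ltnS (leq_trans _ sz) // sp ltn_add2r ltnS size_poly.
- by move=> i; rewrite coef_poly; case: ifP => // _; apply: AD => //; apply: AM.
rewrite xp (horner_coef p) sp horner_poly big_ord_recr /=.
under [RHS]eq_bigr => i _ do rewrite mulrDl -mulrA.
rewrite big_split -mulr_sumr; congr (_ + _ * _).
have := sum_expr_rev (fun j => c j) d.+1 z0; rewrite big_ord_recr /= subnn.
have -> : \sum_(i < d.+2) c i * z^-1 ^+ i = u^-1.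
  have -> : \sum_(i < d.+2) c i * z^-1 ^+ i = x^-1 * r.[z^-1] / u.
    rewrite (@horner_coef_wide _ d.+2) -?sp // mulr_sumr mulr_suml.
    by apply: eq_bigr => i _; rewrite /c; ring.
  by rewrite -xr mulVf // div1r.
move=> /(canRL (addrK _)) ->.
have -> : c 0%N = u^-1 - 1.
  have -> : u^-1 - 1 = (1 - u) / u by rewrite mulrBl divff // mul1r.
  by rewrite /c; congr (_ / _); rewrite /u; ring.
ring.
Qed.

End Maximal.

Lemma place_avoiding : transcendental iota x -> exists2 O, is_place iota O & ~ O x.
Proof.
move=> Hx; have [A HA maxA] := subring_avoiding_max Hx.
exists A; last by case: HA.
case: (HA) => rA _ NAx; split=> //; split; first by exists x.
exact: avoiding_total HA maxA.
Qed.

End PlaceExistence.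


(** * The equation of w over K(x) *)

Section GeneratorPolynomial.
Variables (K : fieldType) (q n'' : nat).
Hypothesis q_gt1 : (1 < q)%N.
Let n' := n''.+1.
Let n := n'.+1.

Definition numer_poly m : {poly {poly K}} :=
  \sum_(i < m) ('X^(q ^ i))%:P * trq i q 'X.

(* The relation between x and w obtained from w = h - h^q + x upon writing h as
   numer_poly / Tr x. *)
Definition gen_poly m : {poly {poly K}} :=
  numer_poly m ^+ q - numer_poly m * (trq m q 'X)%:P ^+ q.-1
    + ('X - 'X%:P) * (trq m q 'X)%:P ^+ q.

Lemma size_trqX (R : nzRingType) i : (size (trq i q ('X : {poly R})) <= q ^ i)%N.
Proof.
apply: (leq_trans (size_sum _ _ _)); apply/bigmax_leqP => j _.
by rewrite size_polyXn ltn_exp2l.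
Qed.

Lemma size_mulC_leq (R : nzRingType) (p : {poly R}) c m :
  (size p <= m)%N -> (size (p * c%:P)%R <= m)%N.
Proof.
move=> pm; apply: (leq_trans (size_polyMleq _ _)).
apply: leq_trans pm; have := size_polyC_leq1 c.
by case: (size c%:P) => [|[|]] // _; rewrite ?addn0 ?addn1 /= ?leq_pred.
Qed.

Lemma numer_polyE : exists2 L : {poly {poly K}}, (size L <= q ^ n'')%N &
  numer_poly n = ('X^(q ^ n')) *: 'X^(q ^ n'') + L.
Proof.
exists (\sum_(i < n') ('X^(q ^ i))%:P * trq i q 'X + ('X^(q ^ n'))%:P * trq n'' q 'X).
  have bound i : (i <= n'')%N ->
      (size (('X^(q ^ i))%:P * trq i q 'X : {poly {poly K}})%R <= q ^ n'')%N.
    move=> le; rewrite mulrC; apply: size_mulC_leq.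
    by apply: (leq_trans (size_trqX _ _)); rewrite leq_exp2l.
  apply: (leq_trans (size_polyD _ _)); rewrite geq_max; apply/andP; split.
    by apply: (leq_trans (size_sum _ _ _)); apply/bigmax_leqP => j _; exact: bound (ltn_ord j).
  by rewrite mulrC; apply: size_mulC_leq; apply: size_trqX.
by rewrite /numer_poly big_ord_recr /= trqS mulrDr -mul_polyC addrA [LHS]addrC.
Qed.

(** Only the q-th power of [numer_poly] reaches the top degree in w. That degree is the N of
    [inf_unit_ev2], so remainders modulo [gen_poly] fall within its range. *)
Lemma gen_poly_lead :
  size (gen_poly n) = (q ^ n').+1 /\ lead_coef (gen_poly n) = 'X^(q ^ n') ^+ q.
Proof.
have [L sL AE] := numer_polyE.
have c0 : 'X^(q ^ n') != 0 :> {poly K} by rewrite expf_neq0 ?polyX_eq0.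
have sX : size ('X^(q ^ n') *: 'X^(q ^ n'') : {poly {poly K}}) = (q ^ n'').+1.
  by rewrite size_scale // size_polyXn.
have sA : size (numer_poly n) = (q ^ n'').+1.
  by rewrite AE size_polyDl sX // ltnS.
have lA : lead_coef (numer_poly n) = 'X^(q ^ n').
  by rewrite AE lead_coefDl ?sX ?ltnS // lead_coefZ lead_coefXn mulr1.
have A0 : numer_poly n != 0 by rewrite -size_poly_gt0 sA.
have sAq : size (numer_poly n ^+ q) = (q ^ n').+1.
  rewrite -[LHS]prednK ?size_poly_gt0 ?expf_neq0 // size_exp sA /=.
  by rewrite -expnSr.
have N2 : (1 < q ^ n')%N by rewrite -{1}(expn0 q) ltn_exp2l.
rewrite /gen_poly -addrA; set L' := (- _ + _).
have sL' : (size L' <= q ^ n')%N.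
  apply: (leq_trans (size_polyD _ _)); rewrite size_polyN geq_max -!rmorphXn.
  rewrite !size_mulC_leq ?size_XsubC // sA.
  by rewrite ltn_exp2l.
split; first by rewrite size_polyDl sAq // ltnS.
by rewrite lead_coefDl ?sAq ?ltnS // lead_coef_exp lA.
Qed.

End GeneratorPolynomial.

Section Generator.
Variables (K E : fieldType) (iota : {rmorphism K -> E}) (q n'' : nat).
Hypothesis q_gt1 : (1 < q)%N.
Hypothesis exprDq : {morph (fun z : E => z ^+ q) : a b / a + b}.
Let n' := n''.+1.
Let n := n'.+1.
Let N := (q ^ n')%N.
Let G : {poly {poly K}} := gen_poly K q n.

Definition unif (x y : E) := y / x - (y / x) ^+ q + x.

Lemma ev1_trqX x m : ev1 iota x (trq m q 'X) = trq m q x.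
Proof.
by rewrite /trq rmorph_sum; apply: eq_bigr => i _; rewrite rmorphXn /= ev1X.
Qed.

Lemma ev2_trqX x y m : ev2 iota x y (trq m q 'X) = trq m q y.
Proof.
by rewrite /trq rmorph_sum; apply: eq_bigr => i _; rewrite rmorphXn /= ev2X.
Qed.

Lemma transcendental_neq0 (x : E) : transcendental iota x -> x != 0.
Proof.
by move/(_ 'X); rewrite polyX_eq0 map_polyX hornerX => /(_ isT).
Qed.

Lemma transcendental_trq (x : E) m : transcendental iota x -> (0 < m)%N ->
  trq m q x != 0.
Proof.
case: m => // m Hx _; rewrite -ev1_trqX.
apply: Hx; rewrite trqS addrC -size_poly_gt0 size_polyDl size_polyXn //.
exact: size_trqX.
Qed.

Section OnePair.
Variables x y : E.
Hypotheses (Hx : transcendental iota x) (Hy : trq n q y = s2 n q x).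
Let w := unif x y.

Let q_gt0 : (0 < q)%N. Proof. exact: ltnW. Qed.
Let x0 : x != 0. Proof. exact: transcendental_neq0. Qed.

Lemma ev2_numer_poly : ev2 iota x w (numer_poly K q n) = y / x * trq n q x.
Proof.
have -> : ev2 iota x w (numer_poly K q n)
    = \sum_(i < n) x ^+ (q ^ i) * trq i q w.
  rewrite /numer_poly rmorph_sum; apply: eq_bigr => i _ /=.
  by rewrite rmorphM /= ev2_trqX ev2C rmorphXn /= ev1X.
have := trq_mul_x q_gt0 exprDq x (y / x) n.
rewrite [x * _]mulrC divfK // Hy -/(unif x y) -/w => /eqP.
by rewrite -addrA eq_sym addrCA -subr_eq0 addrAC subrr add0r subr_eq0 => /eqP ->.
Qed.

Lemma ev2_gen_poly : ev2 iota x w G = 0.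
Proof.
rewrite /G /gen_poly rmorphD rmorphB !rmorphM rmorphB !rmorphXn /=.
rewrite ev2_numer_poly !ev2C ev2X ev1_trqX ev1X.
set T := trq n q x; rewrite exprMn.
have -> : T ^+ q = T * T ^+ q.-1 by rewrite -exprS prednK.
by rewrite /w /unif; ring.
Qed.

(** The coefficients lie in K[x], not in a field, so the division is a pseudo-division and costs a
    power of the leading coefficient of [G]. *)
Lemma ev2_modp (P : {poly {poly K}}) : exists2 c, c != 0 &
  ev2 iota x w (P %% G) = ev1 iota x c * ev2 iota x w P.
Proof.
exists (lead_coef G ^+ scalp P G).
  by rewrite !expf_neq0 // (gen_poly_lead K n'' q_gt1).2 !expf_neq0 ?polyX_eq0.
have := congr1 (ev2 iota x w) (Pdiv.Idomain.divp_eq P G).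
rewrite -mul_polyC rmorphM rmorphD rmorphM /= ev2_gen_poly mulr0 add0r.
by rewrite ev2C => ->.
Qed.

Lemma size_modp_gen (P : {poly {poly K}}) : (size (P %% G)%R <= N)%N.
Proof.
have [sG _] := gen_poly_lead K n'' q_gt1.
by rewrite -ltnS -sG Pdiv.Idomain.ltn_modp -size_poly_gt0 sG.
Qed.

Lemma inf_unif O : is_place iota O -> ~ O x -> place_unit O (w ^+ N / x).
Proof. by move=> HO Ox; apply: (inf_w q_gt1 _ exprDq Hy HO Ox). Qed.

Let N_gt0 : (0 < N)%N. Proof. by rewrite expn_gt0 q_gt0. Qed.

(** A nonzero [P] would have a unit as its normalised value at any place where x has a pole;
    [place_avoiding] supplies such a place. *)
Lemma ev2_inj (P : {poly {poly K}}) : (size P <= N)%N -> ev2 iota x w P = 0 -> P = 0.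
Proof.
move=> sP P0; apply/eqP; apply: contraT => Pn0.
have [M HM] := inf_unit_ev2 N_gt0 inf_unif sP Pn0.
have [O HO Ox] := place_avoiding Hx.
by have [_ _] := HM O HO Ox; rewrite P0 mul0r eqxx.
Qed.

(** The criterion on the right mentions neither x nor y, so all pairs on the curve with
    transcendental first entry have the same relations. *)
Lemma ev2_eq0 (P : {poly {poly K}}) : ev2 iota x w P = 0 <-> P %% G = 0.
Proof.
have [c c0 Ec] := ev2_modp P; split=> [P0|P0].
  by apply: ev2_inj; rewrite ?size_modp_gen // Ec P0 mulr0.
move/eqP: Ec; rewrite P0 rmorph0 eq_sym mulf_eq0 => /orP[|/eqP //].
by move=> /eqP c00; have := Hx c0; rewrite -/(ev1 _ _ _) c00 eqxx.
Qed.

End OnePair.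
End Generator.


(** * Change of generators and extension of homomorphisms *)

Section FractionClosure.
Variables (K E : fieldType) (iota : {rmorphism K -> E}) (x w : E).

Definition in_Kxy (z : E) := exists P Q : {poly {poly K}},
  ev2 iota x w Q != 0 /\ z = ev2 iota x w P / ev2 iota x w Q.

Lemma in_Kxy_ev2 P : in_Kxy (ev2 iota x w P).
Proof. by exists P, 1; rewrite ev2_1 oner_eq0 divr1. Qed.

Lemma in_KxyD a b : in_Kxy a -> in_Kxy b -> in_Kxy (a + b).
Proof.
move=> [P [Q [Q0 ->]]] [P' [Q' [Q0' ->]]].
exists (P * Q' + P' * Q), (Q * Q'); rewrite ev2D !ev2M /=.
by rewrite mulf_neq0 // addf_div.
Qed.

Lemma in_KxyM a b : in_Kxy a -> in_Kxy b -> in_Kxy (a * b).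
Proof.
move=> [P [Q [Q0 ->]]] [P' [Q' [Q0' ->]]].
by exists (P * P'), (Q * Q'); rewrite !ev2M /= mulf_neq0 // mulf_div.
Qed.

Lemma in_KxyV a : in_Kxy a -> in_Kxy a^-1.
Proof.
move=> [P [Q [Q0 ->]]]; have [P0|P0] := eqVneq (ev2 iota x w P) 0.
  by rewrite P0 mul0r invr0 -(ev2_0 iota x w); apply: in_Kxy_ev2.
by exists Q, P; rewrite invf_div.
Qed.

Lemma in_KxyX a k : in_Kxy a -> in_Kxy (a ^+ k).
Proof.
move=> a_in; elim: k => [|k IHk]; last by rewrite exprS; apply: in_KxyM.
by rewrite expr0 -(ev2_1 iota x w); apply: in_Kxy_ev2.
Qed.

Lemma generated_by_trans y : generated_by iota x y -> in_Kxy y ->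
  generated_by iota x w.
Proof.
move=> gen y_in z; have {z} [P [Q [_ ->]]] := gen z.
have ev_in R : in_Kxy (ev2 iota x y R).
  rewrite (ev2E _ _ _ (leqnn _)); apply: big_ind => [||i _].
  - by rewrite -(ev2_0 iota x w); apply: in_Kxy_ev2.
  - exact: in_KxyD.
  - apply: in_KxyM; last exact: in_KxyX.
    by rewrite -(ev2C iota x w); apply: in_Kxy_ev2.
exact: in_KxyM (ev_in P) (in_KxyV (ev_in Q)).
Qed.

End FractionClosure.

Section Extension.
Variables (K E : fieldType) (iota : {rmorphism K -> E}) (x w x' w' : E).
Hypothesis gen : generated_by iota x w.
Hypothesis same_ker : forall P, ev2 iota x w P = 0 <-> ev2 iota x' w' P = 0.

(** Equal kernels make the image of P/Q independent of the fraction that represents it; [fE] is this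
    independence, and the homomorphism laws follow from it. *)
Lemma generated_extension : exists s : E -> E,
  [/\ {morph s : a b / a + b}, {morph s : a b / a * b}, s 1 = 1 &
      forall P, s (ev2 iota x w P) = ev2 iota x' w' P].
Proof.
have ker0 P : (ev2 iota x' w' P != 0) = (ev2 iota x w P != 0).
  congr negb; apply/eqP/eqP => P0; exact/same_ker.
have same P Q : ev2 iota x w P = ev2 iota x w Q -> ev2 iota x' w' P = ev2 iota x' w' Q.
  move=> PQ; apply/eqP; rewrite -subr_eq0 -ev2B; apply/eqP/same_ker.
  by rewrite ev2B /= PQ subrr.
have [s Hs] := boolp.choice gen.
have [t Hst] := boolp.choice Hs.
have Ht z : ev2 iota x w (t z) != 0 /\ z * ev2 iota x w (t z) = ev2 iota x w (s z).
  by have [t0 zE] := Hst z; split=> //; rewrite {1}zE divfK.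
pose f z := ev2 iota x' w' (s z) / ev2 iota x' w' (t z).
have fE z P Q : ev2 iota x w Q != 0 -> z * ev2 iota x w Q = ev2 iota x w P ->
    f z = ev2 iota x' w' P / ev2 iota x' w' Q.
  move=> Q0 zE; have [t0 zst] := Ht z.
  apply/eqP; rewrite eqr_div ?ker0 // -!ev2M; apply/eqP; apply: same.
  by rewrite !ev2M -zE -zst; ring.
have fev P : f (ev2 iota x w P) = ev2 iota x' w' P.
  by rewrite (fE _ P 1) ?ev2_1 ?mulr1 ?divr1 ?oner_eq0.
exists f; split=> //.
- move=> a b; have [a0 aE] := Ht a; have [b0 bE] := Ht b.
  rewrite (fE _ (s a * t b + s b * t a) (t a * t b)) ?ev2M ?mulf_neq0 //=.
    by rewrite /f addf_div ?ker0 // ev2D !ev2M.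
  by rewrite ev2D !ev2M -aE -bE; ring.
- move=> a b; have [a0 aE] := Ht a; have [b0 bE] := Ht b.
  rewrite (fE _ (s a * s b) (t a * t b)) ?ev2M ?mulf_neq0 //=.
    by rewrite /f mulf_div.
  by rewrite -aE -bE; ring.
- by have := fev 1; rewrite !ev2_1.
Qed.

End Extension.

(** * Uniqueness of the place at infinity *)

Section Infinity.
Variables (K E : fieldType) (iota : {rmorphism K -> E}) (q n'' : nat).
Hypothesis q_gt1 : (1 < q)%N.
Hypothesis exprDq : {morph (fun z : E => z ^+ q) : a b / a + b}.
Let n := n''.+2.
Let N := (q ^ n''.+1)%N.

Lemma generated_unif x y : transcendental iota x -> trq n q y = s2 n q x ->
  generated_by iota x y -> generated_by iota x (unif q x y).
Proof.
move=> Hx Hy gen; apply: generated_by_trans gen _.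
have x0 := transcendental_neq0 Hx.
have T0 : trq n q x != 0 by apply: (transcendental_trq q_gt1 Hx).
set w := unif q x y; have -> : y = x * (ev2 iota x w (numer_poly K q n) / trq n q x).
  by rewrite (ev2_numer_poly q_gt1 exprDq Hx Hy) mulfK // mulrC divfK.
have xw_in p : in_Kxy iota x w (ev1 iota x p).
  by rewrite -(ev2C iota x w); apply: in_Kxy_ev2.
apply: in_KxyM; first by have := xw_in 'X; rewrite ev1X.
apply: in_KxyM; first exact: in_Kxy_ev2.
by apply: in_KxyV; have := xw_in (trq n q 'X); rewrite ev1_trqX.
Qed.

Lemma unif_same_ker x y x' y' :
  transcendental iota x -> trq n q y = s2 n q x ->
  transcendental iota x' -> trq n q y' = s2 n q x' ->
  forall P : {poly {poly K}}, ev2 iota x (unif q x y) P = 0 <-> ev2 iota x' (unif q x' y') P = 0.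
Proof.
move=> Hx Hy Hx' Hy' P.
have h := ev2_eq0 q_gt1 exprDq Hx Hy P; have h' := ev2_eq0 q_gt1 exprDq Hx' Hy' P.
by split=> [/h/h'|/h'/h].
Qed.

Section UniqueInf.
Variables x y : E.
Hypotheses (Hx : transcendental iota x) (Hy : trq n q y = s2 n q x).
Hypothesis gen : generated_by iota x y.
Let w := unif q x y.

Lemma reduced_fraction z : exists P Q : {poly {poly K}},
  [/\ (size P <= N)%N, (size Q <= N)%N, ev2 iota x w Q != 0 &
       z = ev2 iota x w P / ev2 iota x w Q].
Proof.
have [P [Q [Q0 ->]]] := generated_unif Hx Hy gen z.
have [c c0 Ec] := ev2_modp q_gt1 exprDq Hx Hy P.
have [d d0 Ed] := ev2_modp q_gt1 exprDq Hx Hy Q.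
have {}c0 : ev1 iota x c != 0 := Hx c0.
have {}d0 : ev1 iota x d != 0 := Hx d0.
(* Pseudo-reduction scales the numerator by c and the denominator by d; multiplying crosswise
   restores the quotient. *)
exists (P %% gen_poly K q n * d%:P), (Q %% gen_poly K q n * c%:P).
rewrite !size_mulC_leq ?size_modp_gen // !ev2M !ev2C Ec Ed.
split=> //; first by rewrite !mulf_neq0.
by field; rewrite c0 d0 Q0.
Qed.

Lemma unif_notin O : is_place iota O -> ~ O x -> ~ O w.
Proof.
move=> HO Ox Ow; apply: (Ox).
have [_ O2 u0] := inf_unif q_gt1 exprDq Hy HO Ox.
have -> : x = (w ^+ N / x)^-1 * w ^+ N.
  rewrite invf_div divfK //; apply: contraNneq u0 => ->; by rewrite mul0r.
by apply: (placeM HO) => //; apply: (placeX HO).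
Qed.

(** A nonzero z is w^(M-L) times an element that is a unit at both places, with the same M and L.
    Since w is a pole at both, membership of z depends only on the sign of M - L. *)
Lemma inf_place_sub O O' : is_place iota O -> ~ O x -> is_place iota O' -> ~ O' x ->
  forall z, O z -> O' z.
Proof.
move=> HO Ox HO' Ox' z Oz; have [P [Q [sP sQ Q0 zE]]] := reduced_fraction z.
have [P0|P0] := eqVneq P 0.
  by rewrite zE P0 ev2_0 mul0r; apply: (place0 HO').
have N0 : (0 < N)%N by rewrite expn_gt0 (ltnW q_gt1).
have Q0' : Q != 0 by apply: contraNneq Q0 => ->; rewrite ev2_0.
have inf := @inf_unif K E iota _ _ q_gt1 exprDq _ _ Hy.
have [M HM] := inf_unit_ev2 N0 inf sP P0.
have [L HL] := inf_unit_ev2 N0 inf sQ Q0'.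
have w0 : w != 0.
  by apply/eqP => w0; apply: (unif_notin HO Ox); rewrite w0; apply: place0 HO.
have U R : is_place iota R -> ~ R x -> place_unit R (z * w ^+ L / w ^+ M).
  move=> HR Rx; have := place_unitM HR (HM R HR Rx) (place_unitV (HL R HR Rx)).
  congr place_unit; rewrite zE; field.
  by rewrite Q0 !expf_neq0.
have z_eq : z = (z * w ^+ L / w ^+ M) * (w ^+ M / w ^+ L).
  by field; rewrite !expf_neq0.
have [ML|ML] := leqP M L.
  rewrite z_eq expr_ratio //; apply: (placeM HO'); first by case: (U O' HO' Ox').
  by apply: (placeX HO'); apply: (placeV HO'); apply: unif_notin.
case: (unif_notin HO Ox); apply: (place_root HO (k := M - L)); first by rewrite subn_gt0.
have -> : w ^+ (M - L) = z * (z * w ^+ L / w ^+ M)^-1.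
  have z0 : z != 0.
    by have [_ _] := U O HO Ox; apply: contraNneq => ->; rewrite !mul0r.
  by rewrite exprB ?unitfE ?(ltnW ML) //; field; rewrite z0 !expf_neq0.
by apply: (placeM HO) => //; case: (U O HO Ox).
Qed.

End UniqueInf.
End Infinity.


(** * Values of polynomials at a place *)

Section PolynomialValues.
Variables (K E : fieldType) (iota : {rmorphism K -> E}).

Lemma poly_split0 (R : nzRingType) (p : {poly R}) :
  exists p', p = p' * 'X + (p`_0)%:P.
Proof.
elim/poly_ind: p => [|p c _]; first by exists 0; rewrite mul0r coef0 polyC0 addr0.
by exists p; rewrite coefD coefMX coefC add0r.
Qed.

Lemma ev1_split0 x (p : {poly K}) : exists p',
  ev1 iota x p = ev1 iota x p' * x + iota p`_0.
Proof.
have [p' Ep] := poly_split0 p; exists p'.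
by rewrite [in LHS]Ep rmorphD rmorphM /= ev1X ev1C.
Qed.

Lemma ev2_split0 x y (P : {poly {poly K}}) : exists P' p,
  ev2 iota x y P = ev2 iota x y P' * y + ev1 iota x p * x + iota P`_0`_0.
Proof.
have [P' EP] := poly_split0 P; have [p Ep] := ev1_split0 x P`_0.
by exists P', p; rewrite [in LHS]EP ev2D ev2M ev2X ev2C Ep addrA.
Qed.

Section InPlace.
Variables (O : E -> Prop) (HO : is_place iota O).

Lemma place_ev1 x (p : {poly K}) : O x -> O (ev1 iota x p).
Proof.
move=> Ox; rewrite ev1E; apply: (place_sum HO) => i _.
by apply: (placeM HO); [apply: (place_iota HO) | apply: (placeX HO)].
Qed.

Lemma place_ev2 x y (P : {poly {poly K}}) : O x -> O y -> O (ev2 iota x y P).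
Proof.
move=> Ox Oy; rewrite (ev2E _ _ _ (leqnn _)); apply: (place_sum HO) => i _.
by apply: (placeM HO); [apply: place_ev1 | apply: (placeX HO)].
Qed.

Lemma place_unit_ev2 x y (P : {poly {poly K}}) :
  place_ideal O x -> place_ideal O y -> P`_0`_0 != 0 ->
  place_unit O (ev2 iota x y P).
Proof.
move=> Px Py P0; have [P' [p ->]] := ev2_split0 x y P.
have [Ox Oy] := (place_idealW Px, place_idealW Py).
rewrite addrC; apply: (place_unitD HO); first exact: place_unit_iota HO _ P0.
by apply: (place_idealD HO); apply: (place_idealM HO) => //;
  [apply: place_ev2 | apply: place_ev1].
Qed.

End InPlace.

(** Once powers of f are cancelled from its relation, the lowest coefficient is a nonzero polynomial
    in x that f divides. *)
Lemma ev2_factor x f (P : {poly {poly K}}) : f != 0 -> P != 0 ->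
  ev2 iota x f P = 0 ->
  exists c g, c != 0 /\ f * ev2 iota x f g = ev1 iota x c.
Proof.
move=> f0; elim/poly_ind: P => [|P c IHP]; first by rewrite eqxx.
rewrite ev2D ev2M ev2X ev2C.
have [-> | c0] := eqVneq c 0; last first.
  move=> _ /eqP; rewrite addrC addr_eq0 => /eqP Ec; exists c, (- P); split=> //.
  by rewrite -[- P]sub0r ev2B ev2_0 sub0r Ec; ring.
rewrite polyC0 addr0 rmorph0 addr0 => PX0 /eqP.
rewrite mulf_eq0 (negPf f0) orbF => /eqP; apply: IHP.
by apply: contraNneq PX0 => ->; rewrite mul0r.
Qed.

Lemma poly_order0 (c : {poly K}) : c != 0 ->
  exists k c', c = c' * 'X^k /\ c'`_0 != 0.
Proof.
elim/poly_ind: c => [|c a IHc]; first by rewrite eqxx.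
have [-> | a0] := eqVneq a 0; last first.
  by move=> _; exists 0%N, (c * 'X + a%:P); rewrite expr0 mulr1 coefD coefMX coefC add0r.
rewrite polyC0 addr0 => cX0.
have [|k [c' [-> c'0]]] := IHc; first by apply: contraNneq cX0 => ->; rewrite mul0r.
by exists k.+1, c'; rewrite exprSr mulrA.
Qed.

End PolynomialValues.

(** * Uniqueness of the place centred at the origin *)

Section Origin.
Variables (K E : fieldType) (iota : {rmorphism K -> E}) (q n' : nat).
Hypothesis q_gt1 : (1 < q)%N.
Let n := n'.+1.
Variables x y : E.
Hypotheses (Hx : transcendental iota x) (Hy : trq n q y = s2 n q x).

Lemma ev1_s2X m : ev1 iota x (s2 m q 'X) = s2 m q x.
Proof.
rewrite /s2 rmorph_sum; apply: eq_bigr => k _; rewrite rmorph_sum.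
by apply: eq_bigr => j _; rewrite rmorphXn /= ev1X.
Qed.

Lemma integral_y : integralOver (ev1 iota x) y.
Proof.
exists (trq n q 'X - (s2 n q 'X)%:P); last first.
  by rewrite rootE -/(ev2 _ _ _ _) ev2B ev2_trqX ev2C ev1_s2X Hy subrr.
rewrite trqS addrAC monicE addrC lead_coefDl ?lead_coefXn // size_polyXn ltnS.
apply: (leq_trans (size_polyD _ _)); rewrite geq_max size_trqX // size_polyN.
by rewrite (leq_trans (size_polyC_leq1 _)) // expn_gt0 (ltnW q_gt1).
Qed.

Lemma integral_ev2 F : integralOver (ev1 iota x) (ev2 iota x y F).
Proof.
apply: integral_horner integral_y; apply/integral_poly => i.
by rewrite coef_map; apply: integral_id.
Qed.

(** [V] is Tr(y)/y and [S] is s2(x)/x. The summand i = 0 gives [V] the constant term 1, hence a unit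
    value at the origin. *)
Let V : {poly {poly K}} := \sum_(i < n) 'X^((q ^ i).-1).
Let S : {poly K} := \sum_(k < n) \sum_(j < k) 'X^((q ^ j + q ^ k).-1).
Let v := ev2 iota x y V.

Let q_gt0i i : (0 < q ^ i)%N. Proof. by rewrite expn_gt0 (ltnW q_gt1). Qed.

(* Near the origin the curve reads y * unit = x * (...), so x is a local
   parameter there. *)
Lemma origin_relation : v * y = ev1 iota x S * x.
Proof.
have -> : v * y = trq n q y.
  rewrite /v -[y in _ * y](ev2X iota x y) -ev2M -(ev2_trqX iota q x); congr ev2.
  by rewrite mulr_suml; apply: eq_bigr => i _; rewrite -exprSr prednK.
rewrite Hy -ev1_s2X -[x in _ * x](ev1X iota x) -rmorphM; congr ev1.
rewrite mulr_suml; apply: eq_bigr => k _; rewrite mulr_suml.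
by apply: eq_bigr => j _; rewrite -exprSr prednK // addn_gt0 q_gt0i.
Qed.

(** Without constant term, F is a multiple of y plus a multiple of x, and [v] converts y into a
    multiple of x. *)
Lemma origin_step (F : {poly {poly K}}) : F`_0`_0 = 0 ->
  exists F', v * ev2 iota x y F = x * ev2 iota x y F'.
Proof.
move=> F0; have [F1 [p ->]] := ev2_split0 iota x y F; rewrite F0 rmorph0 addr0.
exists (S%:P * F1 + p%:P * V); rewrite ev2D !ev2M !ev2C -/v.
rewrite mulrDr mulrCA origin_relation; ring.
Qed.

Section OriginPlace.
Variable O : E -> Prop.
Hypotheses (HO : is_place iota O) (Px : place_ideal O x) (Py : place_ideal O y).

Lemma origin_unit : place_unit O v.
Proof.
apply: place_unit_ev2 => //; rewrite /V big_ord_recl expr0 coefD coef1 coef_sum big1.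
  by rewrite addr0 coef1 oner_eq0.
move=> i _; rewrite coefXn lift0 /=.
by have: (1 < q ^ i.+1)%N; [rewrite -{1}(expn0 q) ltn_exp2l | case: (q ^ i.+1)%N => [|[|]]].
Qed.

(** The place is not known to be discrete, so it must be shown that factors x cannot be extracted
    forever. Since y is integral over K[x], the value f divides some c(x) = c'(x) x^k with c'(0)
    nonzero; extracting k+1 factors would make the unit v^(k+1) c'(x) a multiple of x. *)
Lemma origin_order (F : {poly {poly K}}) : ev2 iota x y F != 0 ->
  exists j (F' : {poly {poly K}}), F'`_0`_0 != 0 /\ v ^+ j * ev2 iota x y F = x ^+ j * ev2 iota x y F'.
Proof.
move=> f0; set f := ev2 _ _ _ F in f0 *; apply: boolp.contrapT => Nj.
have all_j j : exists F', v ^+ j * f = x ^+ j * ev2 iota x y F'.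
  elim: j => [|j [F' IHj]]; first by exists F; rewrite !expr0.
  have [F0|F0] := eqVneq F'`_0`_0 0; last by case: Nj; exists j, F'.
  have [F2 E2] := origin_step F0; exists F2.
  by rewrite exprS -mulrA IHj mulrCA E2 exprSr mulrA.
have [Ox Oy] := (place_idealW Px, place_idealW Py).
have [M monM /rootP M0] := integral_ev2 F; rewrite -/f in M0.
have [c [g [c0 fg]]] := ev2_factor f0 (monic_neq0 monM) M0.
have [k [c' [cE c'0]]] := poly_order0 c0.
have [F' E'] := all_j k.+1.
have x0 := transcendental_neq0 Hx.
have Uc : place_unit O (ev1 iota x c').
  by rewrite -(ev2C iota x y); apply: place_unit_ev2; rewrite ?coefC.
apply: (place_unit_notP (place_unitM HO (place_unitX HO k.+1 origin_unit) Uc)).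
have -> : v ^+ k.+1 * ev1 iota x c' = ev2 iota x y F' * ev2 iota x f g * x.
  apply: (mulIf (expf_neq0 k x0)); rewrite -[LHS]mulrA.
  have -> : ev1 iota x c' * x ^+ k = f * ev2 iota x f g.
    by rewrite fg cE rmorphM rmorphXn /= ev1X.
  by rewrite mulrA E' exprS; ring.
apply: (place_idealM HO) Px; apply: (placeM HO); apply: place_ev2 => //.
exact: place_ev2.
Qed.

End OriginPlace.

(** As at infinity, a nonzero z is x^(i-j) times an element that is a unit at every place centred at
    the origin. *)
Lemma origin_place_sub O O' : generated_by iota x y ->
  is_place iota O -> place_ideal O x -> place_ideal O y ->
  is_place iota O' -> place_ideal O' x -> place_ideal O' y ->
  forall z, O z -> O' z.
Proof.
move=> gen HO Px Py HO' Px' Py' z Oz; have [F [G [g0 zE]]] := gen z.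
have [f0|f0] := eqVneq (ev2 iota x y F) 0.
  by rewrite zE f0 mul0r; apply: (place0 HO').
have [i [F1 [F1u EF]]] := origin_order HO Px Py f0.
have [j [G1 [G1u EG]]] := origin_order HO Px Py g0.
have x0 := transcendental_neq0 Hx.
have [_ _ v0] := origin_unit HO Px Py.
have [_ _ F10] := place_unit_ev2 HO Px Py F1u.
have [_ _ G10] := place_unit_ev2 HO Px Py G1u.
pose u := ev2 iota x y F1 / ev2 iota x y G1 * v ^+ j / v ^+ i.
have Uu R : is_place iota R -> place_ideal R x -> place_ideal R y -> place_unit R u.
  move=> HR PRx PRy; have Uv := origin_unit HR PRx PRy.
  have UF := place_unit_ev2 HR PRx PRy F1u; have UG := place_unit_ev2 HR PRx PRy G1u.
  apply: (place_unitM HR _ (place_unitV (place_unitX HR i Uv))).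
  exact: (place_unitM HR (place_unitM HR UF (place_unitV UG)) (place_unitX HR j Uv)).
have zu : z = u * (x ^+ i / x ^+ j).
  have -> : u * (x ^+ i / x ^+ j) =
      (x ^+ i * ev2 iota x y F1) * v ^+ j / (x ^+ j * ev2 iota x y G1 * v ^+ i).
    by rewrite /u; field; rewrite G10 !expf_neq0.
  by rewrite -EF -EG zE; field; rewrite g0 !expf_neq0.
have [ji|ij] := leqP j i.
  rewrite zu; apply: (placeM HO'); first by case: (Uu O' HO' Px' Py').
  rewrite -(subnK ji) exprD mulfK ?expf_neq0 //.
  by apply: (placeX HO'); apply: place_idealW.
have [_ Ou u0] := Uu O HO Px Py.
case: Px => _ [/eqP|[]]; first by rewrite (negPf x0).
apply: (place_root HO (k := j - i)); first by rewrite subn_gt0.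
rewrite -expr_ratio ?(ltnW ij) //.
by rewrite -[_ / _](mulKf u0) -zu; apply: (placeM HO).
Qed.

End Origin.


(** * Counting the points (tau, delta) *)

Section FiniteField.
Variables (K : finFieldType) (q n' : nat).
Hypothesis q_gt1 : (1 < q)%N.
Let n := n'.+1.
Hypothesis HK : #|K| = (q ^ n)%N.
Hypothesis exprDq : {morph (fun z : K => z ^+ q) : a b / a + b}.
Let q_gt0 : (0 < q)%N. Proof. exact: ltnW. Qed.

Lemma expqn (a : K) : a ^+ (q ^ n) = a. Proof. by rewrite -HK expf_card. Qed.

Lemma trq_fixed (a : K) : trq n q a ^+ q = trq n q a.
Proof. by rewrite trq_expq // trqS expqn addrK. Qed.

Lemma s2_fixed (a : K) : s2 n q a ^+ q = s2 n q a.
Proof. by rewrite s2_expq // s2S trqS expqn; ring. Qed.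

Lemma card_le_roots (p : {poly K}) (A : {set K}) :
  p != 0 -> (forall a, a \in A -> root p a) -> (#|A| < size p)%N.
Proof.
move=> p0 Ap; rewrite cardE; apply: max_poly_roots p0 _ (enum_uniq _).
by apply/allP => a; rewrite mem_enum; apply: Ap.
Qed.

(** Double counting: the q^n elements of K fall into fibres over at most q values, and by degree
    each fibre has at most q^(n-1) elements, so equality holds throughout. *)
Lemma card_trq_fiber (c : K) : c ^+ q = c ->
  #|[set d | trq n q d == c]| = (q ^ n')%N.
Proof.
pose fib c := [set d : K | trq n q d == c].
pose Fq := [set c : K | c ^+ q == c].
have size_Xq m : (0 < m)%N -> forall r : {poly K}, (size r <= m)%N ->
    size ('X^m + r) = m.+1.
  by move=> m0 r sr; rewrite size_polyDl size_polyXn // ltnS.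
have cardF : (#|Fq| <= q)%N.
  have sp : size ('X^q + - 'X : {poly K}) = q.+1 by rewrite size_Xq // size_polyN size_polyX.
  rewrite -ltnS -sp; apply: card_le_roots; first by rewrite -size_poly_gt0 sp.
  by move=> a; rewrite inE rootE !hornerE subr_eq0.
have card_fib d : (#|fib d| <= q ^ n')%N.
  have sp : size (trq n q 'X - d%:P : {poly K}) = (q ^ n').+1.
    rewrite trqS addrAC addrC size_Xq ?expn_gt0 ?q_gt0 //.
    rewrite (leq_trans (size_polyD _ _)) // geq_max size_trqX // size_polyN.
    by rewrite (leq_trans (size_polyC_leq1 _)) // expn_gt0 q_gt0.
  rewrite -ltnS -sp; apply: card_le_roots; first by rewrite -size_poly_gt0 sp.
  move=> a; rewrite inE => /eqP <-; rewrite rootE hornerD hornerN hornerC subr_eq0.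
  rewrite /trq horner_sum; apply/eqP; apply: eq_bigr => i _.
  by rewrite hornerXn.
have sum_fib : (\sum_(d in Fq) #|fib d| = q ^ n)%N.
  rewrite -HK -[RHS]sum1_card [RHS](partition_big (trq n q) (mem Fq)) /=.
    by apply: eq_bigr => d _; rewrite -sum1_card; apply: eq_bigl => a; rewrite inE.
  by move=> a _; rewrite inE trq_fixed.
move=> cq; have cF : c \in Fq by rewrite inE cq.
have [_] := leqif_sum (fun d (_ : d \in Fq) => leqif_eq (card_fib d)).
rewrite sum_fib sum_nat_const => eqc; apply/eqP.
have: (q ^ n == #|Fq| * q ^ n')%N.
  rewrite eqn_leq; apply/andP; split; last by rewrite expnS leq_mul2r cardF orbT.
  by rewrite -sum_fib -sum_nat_const; apply: leq_sum => d _.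
by rewrite eqc => /forall_inP/(_ c cF).
Qed.

Lemma card_curve :
  #|[set a : K * K | trq n q a.2 == s2 n q a.1]| = (q ^ (n + n'))%N.
Proof.
rewrite -sum1_card (eq_bigl (fun a => true && (trq n q a.2 == s2 n q a.1))).
  rewrite -(pair_big_dep xpredT (fun t d => trq n q d == s2 n q t) (fun _ _ => 1%N)) /=.
  under eq_bigr => t _.
    have -> : (\sum_(d | trq n q d == s2 n q t) 1 = q ^ n')%N.
      rewrite -(card_trq_fiber (s2_fixed t)) -sum1_card.
      by apply: eq_bigl => d; rewrite inE.
    over.
  by rewrite sum_nat_const HK -expnD.
by move=> a; rewrite inE.
Qed.

End FiniteField.

(** * Homomorphisms over K and their action on places *)

Section KHom.
Variables (K E : fieldType) (iota : {rmorphism K -> E}).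

(** Bijectivity is left out because [generated_extension] provides only a homomorphism; inverses
    come later from inverse pairs. *)
Definition is_Khom (s : E -> E) := [/\ {morph s : a b / a + b},
  {morph s : a b / a * b}, s 1 = 1 & forall c, s (iota c) = iota c].

Lemma Khom_id : is_Khom id. Proof. by []. Qed.

Section OneHom.
Variable s : E -> E.
Hypothesis Hs : is_Khom s.

Lemma KhomD : {morph s : a b / a + b}. Proof. by case: Hs. Qed.
Lemma KhomM : {morph s : a b / a * b}. Proof. by case: Hs. Qed.
Lemma Khom1 : s 1 = 1. Proof. by case: Hs. Qed.
Lemma Khom_iota c : s (iota c) = iota c. Proof. by case: Hs. Qed.
Lemma Khom0 : s 0 = 0. Proof. by rewrite -(rmorph0 iota) Khom_iota. Qed.
Lemma KhomX k : {morph s : a / a ^+ k}.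
Proof.
by move=> a; elim: k => [|k IHk]; rewrite ?Khom1 // !exprS KhomM IHk.
Qed.
Lemma Khom_sum (I : Type) (r : seq I) (P : pred I) (F : I -> E) :
  s (\sum_(i <- r | P i) F i) = \sum_(i <- r | P i) s (F i).
Proof. exact: (big_morph s KhomD Khom0). Qed.
Lemma Khom_eq0 a : (s a == 0) = (a == 0).
Proof.
have [-> | a0] := eqVneq a 0; first by rewrite Khom0 eqxx.
apply: contraTF (oner_neq0 E) => /eqP sa0; rewrite negbK.
by rewrite -Khom1 -(divff a0) KhomM sa0 mul0r.
Qed.
Lemma KhomV : {morph s : a / a^-1}.
Proof.
move=> a; have [-> | a0] := eqVneq a 0; first by rewrite invr0 Khom0 invr0.
have sa0 : s a != 0 by rewrite Khom_eq0.
by apply: (mulfI sa0); rewrite -KhomM !divff // Khom1.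
Qed.
Lemma Khom_div a b : s (a / b) = s a / s b.
Proof. by rewrite KhomM KhomV. Qed.
Lemma Khom_ev1 x p : s (ev1 iota x p) = ev1 iota (s x) p.
Proof.
rewrite !ev1E Khom_sum; apply: eq_bigr => i _.
by rewrite KhomM KhomX Khom_iota.
Qed.
Lemma Khom_ev2 x y P : s (ev2 iota x y P) = ev2 iota (s x) (s y) P.
Proof.
rewrite !(ev2E _ _ _ (leqnn _)) Khom_sum; apply: eq_bigr => i _.
by rewrite KhomM KhomX Khom_ev1.
Qed.

Lemma Khom_place_ideal (O : E -> Prop) z :
  place_ideal (fun a => O (s a)) z <-> place_ideal O (s z).
Proof.
by rewrite /place_ideal KhomV; split=> -[Oz [/eqP z0|z1]]; split=> //;
  first [by right | left; apply/eqP; move: z0; rewrite Khom_eq0].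
Qed.

Lemma Khom_place (O : E -> Prop) t : cancel t s -> is_place iota O ->
  is_place iota (fun a => O (s a)).
Proof.
move=> st HO; have sN b : s (- b) = - s b.
  by apply/eqP; rewrite -addr_eq0 -KhomD addNr Khom0.
split; [split | split].
- by rewrite Khom1; apply: place1 HO.
- by move=> a b Oa Ob; rewrite KhomD sN; apply: (placeB HO).
- by move=> a b Oa Ob; rewrite KhomM; apply: (placeM HO).
- by move=> c; rewrite Khom_iota; apply: (place_iota HO).
- by case: (HO) => _ [[z NOz] _]; exists (t z); rewrite st.
- by move=> z z0; rewrite KhomV; apply: (place_total HO); rewrite Khom_eq0.
Qed.

End OneHom.

Lemma Khom_comp s t : is_Khom s -> is_Khom t -> is_Khom (s \o t).
Proof.
move=> Hs Ht; split=> [a b|a b||c] /=.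
- by rewrite (KhomD Ht) (KhomD Hs).
- by rewrite (KhomM Ht) (KhomM Hs).
- by rewrite (Khom1 Ht) (Khom1 Hs).
- by rewrite (Khom_iota Ht) (Khom_iota Hs).
Qed.

(** Reduces the composition and inversion laws of Gamma to a computation on x and y. *)
Lemma Khom_eq x y s t : generated_by iota x y -> is_Khom s -> is_Khom t ->
  s x = t x -> s y = t y -> s =1 t.
Proof.
move=> gen Hs Ht sx sy z; have [P [Q [_ ->]]] := gen z.
by rewrite (Khom_div Hs) (Khom_div Ht) !(Khom_ev2 Hs) !(Khom_ev2 Ht) sx sy.
Qed.

Lemma ev1_comp x p r : ev1 iota x (p \Po r) = ev1 iota (ev1 iota x r) p.
Proof. by rewrite /ev1 map_comp_poly horner_comp. Qed.

Lemma ev1_shift x c p :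
  ev1 iota (x + iota c) p = ev1 iota x (p \Po ('X + c%:P)).
Proof. by rewrite ev1_comp rmorphD /= ev1X ev1C. Qed.

Lemma transcendental_shift x c : transcendental iota x ->
  transcendental iota (x + iota c).
Proof.
move=> Hx p p0; rewrite -/(ev1 _ _ _) ev1_shift; apply: Hx.
by apply: contraNneq p0 => pc; rewrite -(comp_polyXaddC_K p c) pc comp_poly0.
Qed.

Lemma Khom_in_Kx s x c z : is_Khom s -> s x = x + iota c ->
  in_Kx iota x z -> in_Kx iota x (s z).
Proof.
move=> Hs sx [p [r [r0 ->]]].
exists (p \Po ('X + c%:P)), (r \Po ('X + c%:P)).
by rewrite -!ev1_shift -sx -!(Khom_ev1 Hs) (Khom_eq0 Hs) (Khom_div Hs).
Qed.

End KHom.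


(** * The group Gamma and its action on affine places of degree one *)

Section Curve.
Variables (K : finFieldType) (E : fieldType) (iota : {rmorphism K -> E}).
Variables (q n'' : nat).
Hypothesis q_gt1 : (1 < q)%N.
Let n := n''.+2.
Hypothesis HK : #|K| = (q ^ n)%N.
Hypothesis exprDqK : {morph (fun z : K => z ^+ q) : a b / a + b}.
Hypothesis exprDqE : {morph (fun z : E => z ^+ q) : a b / a + b}.
Variables x y : E.
Hypotheses (Hx : transcendental iota x) (Hy : trq n q y = s2 n q x).
Hypothesis gen : generated_by iota x y.
Let q_gt0 : (0 < q)%N. Proof. exact: ltnW. Qed.

Let S := [set a : K * K | trq n q a.2 == s2 n q a.1].
Let tl (u : K) := trq n q u - u.

(** Read off from the composite of the maps of [a] and [b]: the first map sends x [tl b.1] to (x +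
    [a.1]) [tl b.1], whence the twist by [a.1 * tl b.1]. *)
Let mul (a b : K * K) := (a.1 + b.1, a.2 + a.1 * tl b.1 + b.2).
Let inv (a : K * K) := (- a.1, - a.2 + a.1 * tl a.1).

Let tlD a b : tl (a + b) = tl a + tl b.
Proof. by rewrite /tl (trqD exprDqK); ring. Qed.
Let tlN a : tl (- a) = - tl a.
Proof. by rewrite /tl (trqN q_gt0 exprDqK); ring. Qed.

Lemma curve_mul a b : a \in S -> b \in S -> mul a b \in S.
Proof.
rewrite !inE => /eqP Sa /eqP Sb; apply/eqP.
exact: (trq_shift q_gt0 exprDqK (trq_fixed q_gt1 HK exprDqK _)).
Qed.

Lemma curve_inv a : a \in S -> inv a \in S.
Proof.
rewrite !inE => /eqP Sa; apply/eqP; rewrite /= /tl (trqD exprDqK).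
rewrite (trqN q_gt0 exprDqK) mulrBr (trqB q_gt0 exprDqK) trq_mul_fixed //; last first.
  exact: (trq_fixed q_gt1 HK exprDqK).
by rewrite (s2N q_gt0 exprDqK) Sa; ring.
Qed.

Lemma iota_trq c : iota (trq n q c) = trq n q (iota c).
Proof. by rewrite /trq rmorph_sum; apply: eq_bigr => i _; rewrite rmorphXn. Qed.

Lemma iota_s2 c : iota (s2 n q c) = s2 n q (iota c).
Proof.
rewrite /s2 rmorph_sum; apply: eq_bigr => i _; rewrite rmorph_sum.
by apply: eq_bigr => j _; rewrite rmorphXn.
Qed.

Definition curve_auto (a : K * K) (s : E -> E) := [/\ is_Khom iota s,
  s x = x + iota a.1 & s y = y + x * iota (tl a.1) + iota a.2].

Lemma curve_auto_exists a : a \in S -> exists s, curve_auto a s.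
Proof.
rewrite inE => /eqP Sa.
pose x' := x + iota a.1; pose y' := y + x * iota (tl a.1) + iota a.2.
have Hx' : transcendental iota x' by apply: transcendental_shift.
have Hy' : trq n q y' = s2 n q x'.
  rewrite /y' /tl rmorphB iota_trq; apply: (trq_shift q_gt0 exprDqE) => //.
    by rewrite -iota_trq -rmorphXn (trq_fixed q_gt1 HK exprDqK).
  by rewrite -iota_trq Sa iota_s2.
have same := unif_same_ker q_gt1 exprDqE Hx Hy Hx' Hy'.
have [s [sD sM s1 sev]] := generated_extension (generated_unif q_gt1 exprDqE Hx Hy gen) same.
exists s.
have si c : s (iota c) = iota c.
  by have := sev c%:P%:P; rewrite !ev2C !ev1C.
have Hs : is_Khom iota s by [].
have sx : s x = x' by have := sev 'X%:P; rewrite !ev2C !ev1X.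
split=> //.
(* The second coordinate is one and the same rational expression in X and [unif q X Y] for every
   such pair, so the value of [s] at y follows from its values at x and w. *)
have num X Y (HX : transcendental iota X) (HY : trq n q Y = s2 n q X) :
    Y = X * (ev2 iota X (unif q X Y) (numer_poly K q n) / ev1 iota X (trq n q 'X)).
  have X0 := transcendental_neq0 HX.
  have T0 : trq n q X != 0 by apply: (transcendental_trq q_gt1 HX).
  by rewrite ev1_trqX (ev2_numer_poly q_gt1 exprDqE HX HY) mulfK // mulrC divfK.
rewrite [in LHS](num x y Hx Hy) (KhomM Hs) (Khom_div Hs) sev (Khom_ev1 Hs) sx.
by rewrite -num.
Qed.

Section Sigma.
Variable sig : K * K -> E -> E.
Hypothesis Hsig : forall a, a \in S -> curve_auto a (sig a).

Lemma sig_mul a b : a \in S -> b \in S -> sig (mul a b) =1 sig a \o sig b.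
Proof.
move=> Sa Sb; have [Ha ax ay] := Hsig Sa; have [Hb bx b_y] := Hsig Sb.
have [Hc cx cy] := Hsig (curve_mul Sa Sb).
apply: (Khom_eq gen Hc (Khom_comp Ha Hb)) => /=.
  by rewrite cx bx (KhomD Ha) (Khom_iota Ha) ax rmorphD addrA.
rewrite cy b_y !(KhomD Ha) (KhomM Ha) !(Khom_iota Ha) ax ay /=.
rewrite tlD; move: (tl a.1) (tl b.1) => u v.
by rewrite !rmorphD rmorphM /=; ring.
Qed.

Lemma sig_invK a : a \in S -> cancel (sig a) (sig (inv a)).
Proof.
move=> Sa; have [Ha ax ay] := Hsig Sa; have [Hb bx b_y] := Hsig (curve_inv Sa).
apply: (Khom_eq gen (Khom_comp Hb Ha) (Khom_id iota)) => /=.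
  by rewrite ax (KhomD Hb) (Khom_iota Hb) bx rmorphN addrNK.
rewrite ay !(KhomD Hb) (KhomM Hb) !(Khom_iota Hb) bx b_y /= tlN.
by move: (tl a.1) => u; rewrite !rmorphD !rmorphN rmorphM /=; ring.
Qed.

Lemma sig_invVK a : a \in S -> cancel (sig (inv a)) (sig a).
Proof.
move=> Sa; have [Ha ax ay] := Hsig Sa; have [Hb bx b_y] := Hsig (curve_inv Sa).
apply: (Khom_eq gen (Khom_comp Ha Hb) (Khom_id iota)) => /=.
  by rewrite bx (KhomD Ha) (Khom_iota Ha) ax rmorphN addrK.
rewrite b_y !(KhomD Ha) (KhomM Ha) !(Khom_iota Ha) ax ay /= tlN.
by move: (tl a.1) => u; rewrite !rmorphD !rmorphN rmorphM /=; ring.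
Qed.

Lemma sig_inj : {in S &, injective sig}.
Proof.
move=> [a1 a2] [b1 b2] Sa Sb ab.
have [_ ax ay] := Hsig Sa; have [_ bx b_y] := Hsig Sb.
have E1 : a1 = b1.
  by move: ax; rewrite ab bx => /addrI/fmorph_inj.
by move: ay; rewrite ab b_y /= E1 => /addrI/fmorph_inj ->.
Qed.

Lemma sig_in_Kx a z : a \in S -> in_Kx iota x z <-> in_Kx iota x (sig a z).
Proof.
move=> Sa; have [Ha ax _] := Hsig Sa; have [Hb bx _] := Hsig (curve_inv Sa).
split; first exact: Khom_in_Kx Ha ax.
by move/(Khom_in_Kx Hb bx); rewrite sig_invK.
Qed.

Lemma place_y (O : E -> Prop) : is_place iota O -> O x -> O y.
Proof.
move=> HO Ox.
apply: (@place_integral _ _ _ _ HO 'I_n''.+1 (fun=> 1) (fun i => q ^ i)%N (q ^ n''.+1)).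
- by rewrite expn_gt0 q_gt0.
- by move=> _; apply: place1 HO.
- by move=> i; rewrite ltn_exp2l.
under eq_bigr => i _ do rewrite mul1r.
rewrite addrC -/(trq _ _ _) -trqS Hy; apply: (place_sum HO) => k _.
by apply: (place_sum HO) => j _; apply: (placeX HO).
Qed.

(** Subtracting the curve equation at (x, y) presents the constant Tr(b) - s2(a) as an element of
    the maximal ideal, so it vanishes. *)
Lemma center_on_curve (O : E -> Prop) a b : is_place iota O ->
  place_ideal O (x - iota a) -> place_ideal O (y - iota b) -> (a, b) \in S.
Proof.
move=> HO Pa Pb; rewrite inE /= -subr_eq0; apply/eqP/(place_ideal_iota HO).
have Ptr u : place_ideal O u -> place_ideal O (trq n q u).
  move=> Pu; apply: (place_ideal_sum HO) => i _; apply: (place_idealX HO Pu).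
  by rewrite expn_gt0 q_gt0.
have Os2 : place_ideal O (s2 n q (x - iota a)).
  apply: (place_ideal_sum HO) => k _; apply: (place_ideal_sum HO) => j _.
  by apply: (place_idealX HO Pa); rewrite addn_gt0 expn_gt0 q_gt0.
have -> : iota (trq n q b - s2 n q a) =
    (s2 n q (x - iota a) + iota (trq n q a) * trq n q (x - iota a)
      - trq n q (iota a * (x - iota a))) - trq n q (y - iota b).
  have s2x := s2D exprDqE n (x - iota a) (iota a); rewrite subrK in s2x.
  rewrite rmorphB (trqB q_gt0 exprDqE n y) Hy s2x [iota a * (x - _)]mulrC.
  by rewrite !iota_trq iota_s2; ring.
apply: (place_idealB HO); last exact: Ptr.
apply: (place_idealB HO); last by apply: Ptr; apply: (place_idealM HO) => //; apply: place_iota HO _.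
by apply: (place_idealD HO) => //; apply: (place_idealM HO); [apply: (place_iota HO) | apply: Ptr].
Qed.

Lemma place_to_origin (O : E -> Prop) : is_place iota O -> degree_one iota O -> O x ->
  exists2 c, c \in S & place_ideal O (sig c x) /\ place_ideal O (sig c y).
Proof.
move=> HO deg1 Ox; have [a Pa] := deg1 x Ox; have [b Pb] := deg1 y (place_y HO Ox).
have Sab := center_on_curve HO Pa Pb.
(* This map sends x to x - a, and y to (y - b) - [tl a] (x - a); both lie in the maximal ideal. *)
exists (inv (a, b)); first exact: curve_inv.
have [_ -> ->] := Hsig (curve_inv Sab); rewrite /= rmorphN; split=> //.
have -> : y + x * iota (tl (- a)) + iota (- b + a * tl a)
    = (y - iota b) - iota (tl a) * (x - iota a).
  by rewrite tlN; move: (tl a) => u; rewrite rmorphD !rmorphN rmorphM /=; ring.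
by apply: (place_idealB HO) => //; apply: (place_idealM HO); first exact: place_iota HO _.
Qed.

Lemma sig_transitive (O1 O2 : E -> Prop) :
  is_place iota O1 -> degree_one iota O1 -> O1 x ->
  is_place iota O2 -> degree_one iota O2 -> O2 x ->
  exists2 a, a \in S & forall z, O1 z <-> O2 (sig a z).
Proof.
move=> HO1 d1 O1x HO2 d2 O2x.
have [c1 S1 [Px1 Py1]] := place_to_origin HO1 d1 O1x.
have [c2 S2 [Px2 Py2]] := place_to_origin HO2 d2 O2x.
have [H1 _ _] := Hsig S1; have [H2 _ _] := Hsig S2.
have Q1 := Khom_place H1 (sig_invVK S1) HO1.
have Q2 := Khom_place H2 (sig_invVK S2) HO2.
have {}Px1 := (Khom_place_ideal H1 _ _).2 Px1; have {}Py1 := (Khom_place_ideal H1 _ _).2 Py1.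
have {}Px2 := (Khom_place_ideal H2 _ _).2 Px2; have {}Py2 := (Khom_place_ideal H2 _ _).2 Py2.
(* The pullbacks of [O1] by [sig c1] and of [O2] by [sig c2] are both centred at the origin, hence
   equal; transporting back along [sig c1] gives this pair. *)
exists (mul c2 (inv c1)); first by apply: curve_mul => //; apply: curve_inv.
move=> z; rewrite sig_mul //=; last exact: curve_inv.
rewrite -{1}[z](sig_invVK S1).
split; first exact: (origin_place_sub q_gt1 Hx Hy gen Q1 Px1 Py1 Q2 Px2 Py2).
exact: (origin_place_sub q_gt1 Hx Hy gen Q2 Px2 Py2 Q1 Px1 Py1).
Qed.

End Sigma.
End Curve.

Lemma exprDq_pchar (R : comNzRingType) p m : p \in [pchar R] ->
  {morph (fun z : R => z ^+ (p ^ m)) : a b / a + b}.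
Proof.
move=> pR a b; rewrite /= exprDn_pchar // (eq_pnat _ (pcharf_eq pR)).
by rewrite pnatX pnat_id ?(pcharf_prime pR).
Qed.

Theorem theorem6p1
  (p m q n : nat) (Hp : prime p) (Hm : (0 < m)%N) (Hq : q = (p ^ m)%N)
  (Hn : (2 <= n)%N)
  (K : finFieldType) (HK : #|K| = (q ^ n)%N)
  (E : fieldType) (iota : {rmorphism K -> E}) (x y : E)
  (Hx : transcendental iota x)
  (Hy : trq n q y = s2 n q x)
  (HE : generated_by iota x y) :
  let S := [set a : K * K | trq n q a.2 == s2 n q a.1] in
  exists sig : K * K -> E -> E,
    (* the automorphisms sigma_{tau,delta} *)
    (forall a, a \in S ->
       [/\ is_Kaut iota (sig a),
           sig a x = x + iota a.1,
           sig a y = y + x * iota (\sum_(1 <= i < n) a.1 ^+ (q ^ i)) + iota a.2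
         & forall z, in_Kx iota x z <-> in_Kx iota x (sig a z)]) /\
    (* Gamma = { sig a | a \in S } is a subgroup of Aut(E/K) of order q^(2n-1) *)
    {in S &, injective sig} /\
    #|S| = (q ^ (2 * n - 1))%N /\
    (forall a b, a \in S -> b \in S ->
       exists2 c, c \in S & forall z, sig c z = sig a (sig b z)) /\
    (forall a, a \in S -> exists2 c, c \in S & forall z, sig c (sig a z) = z) /\
    (* there is a unique place lying over the pole of x *)
    (exists Oinf : E -> Prop, is_place iota Oinf /\ ~ Oinf x /\
       forall O, is_place iota O -> ~ O x -> forall z, O z <-> Oinf z) /\
    (* Gamma acts transitively on the other places of degree one *)
    (forall O1 O2 : E -> Prop,
       is_place iota O1 -> degree_one iota O1 -> O1 x ->
       is_place iota O2 -> degree_one iota O2 -> O2 x ->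
       exists2 a, a \in S & forall z, O1 z <-> O2 (sig a z)).

Proof.
move=> S; case: n Hn HK Hy @S => [|[|n'']] // _ {}HK {}Hy S.
have pK : p \in [pchar K].
  by apply: (card_finPcharP (n := m * n''.+2)); rewrite // HK Hq expnM.
have exprDqK : {morph (fun z : K => z ^+ q) : a b / a + b}.
  by rewrite Hq; apply: exprDq_pchar.
have exprDqE : {morph (fun z : E => z ^+ q) : a b / a + b}.
  by rewrite Hq; apply: exprDq_pchar; apply: (rmorph_pchar iota).
have q_gt1 : (1 < q)%N by rewrite Hq -{1}(exp1n m) ltn_exp2r // prime_gt1.
(* The choice of [sig] runs over all pairs, so a map is also supplied off the curve, where its value
   is arbitrary. *)
have ex a : exists s, a \in S -> curve_auto iota q n'' x y a s.
  have [Sa|] := boolP (a \in S); last by exists id.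
  by have [s Hs] := curve_auto_exists q_gt1 HK exprDqK exprDqE Hx Hy HE Sa; exists s.
have [sig Hsig] := boolp.choice ex; exists sig.
have sK := sig_invK q_gt1 HK exprDqK HE Hsig.
have sVK := sig_invVK q_gt1 HK exprDqK HE Hsig.
have Sinv := curve_inv q_gt1 HK exprDqK.
split.
  move=> a Sa; have [[aD aM a1 ai] ax ay] := Hsig a Sa.
  split=> //; last by move=> z; apply: (sig_in_Kx q_gt1 HK exprDqK HE Hsig).
  - split=> //; exists (sig (- a.1, - a.2 + a.1 * (trq n''.+2 q a.1 - a.1))).
      exact: sK.
    exact: sVK.
  - by rewrite ay sum_trq.
split; first exact: sig_inj Hsig.
split; first by rewrite (card_curve q_gt1 HK exprDqK); congr (_ ^ _)%N; lia.
split.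
  move=> a b Sa Sb; eexists; first exact: (curve_mul q_gt1 HK exprDqK Sa Sb).
  exact: (sig_mul q_gt1 HK exprDqK HE Hsig Sa Sb).
split; first by move=> a Sa; eexists; [exact: (Sinv a Sa) | exact: sK].
split.
  have [O HO Ox] := place_avoiding Hx; exists O; split=> //; split=> // O' HO' Ox' z.
  split; first exact: (inf_place_sub q_gt1 exprDqE Hx Hy HE HO' Ox' HO Ox).
  exact: (inf_place_sub q_gt1 exprDqE Hx Hy HE HO Ox HO' Ox').
exact: (sig_transitive q_gt1 HK exprDqK exprDqE Hx Hy HE Hsig).
Qed.
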